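(* Let $\pi$ be a set of primes, let $G$ be a finite $\pi$-separable group, and let $N$ be a normal subgroup of $G$. Let $\zeta \in \mathrm{I}_{\pi}(G)$ and let $\mathrm{I}_{\pi}(G/N) = \{\kappa_1, \dots, \kappa_n\}$ (the $\kappa_i$ being the distinct elements). Assume that $G/N$ is a $\pi$-group and that $\kappa_1\zeta, \dots, \kappa_n\zeta$ are distinct and irreducible (i.e. are distinct elements of $\mathrm{I}_\pi(G)$). Then $\zeta_N$ is irreducible, i.e. $\zeta_N\in \mathrm{I}_\pi(N)$.
   Context: Let $G$ be a finite $\pi$-separable group (one having a normal series each of whose factors is a $\pi$-group or a $\pi'$-group). Let $G^o$ be the set of $\pi$-elements of $G$ (elements whose order is divisible only by primes in $\pi$). For a complex character $\chi$ of $G$, $\chi^o$ denotes the restriction of $\chi$ to $G^o$. A $\pi$-partial character of $G$ is a function on $G^o$ of the form $\chi^o$ for some character $\chi$ of $G$. A $\pi$-partial character is irreducible if it cannot be written as a sum of two $\pi$-partial characters; $\mathrm{I}_\pi(G)$ is the set of irreducible $\pi$-partial characters of $G$. For $N\trianglelefteq G$ and a $\pi$-partial character $\zeta$ of $G$, $\zeta_N$ is the restriction of $\zeta$ to $N^o$. Partial characters of $G/N$ are viewed as partial characters of $G$ by inflation, so $(\kappa\zeta)(g)=\kappa(gN)\zeta(g)$ for $g\in G^o$. *)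

(* Defs.v *)
From mathcomp Require Import all_boot all_order all_fingroup all_algebra.
From mathcomp Require Import all_solvable all_field all_character.

Set Implicit Arguments.
Unset Strict Implicit.
Unset Printing Implicit Defensive.

Import GRing.Theory.
Local Open Scope group_scope.
Local Open Scope ring_scope.

(* A set of primes pi is a [nat_pred]: as usual in the library, only the      *)
(* primes belonging to it matter.                                             *)

(* [invariant_factor G U V] states that U <| V and that G normalises U and V. *)
Definition pi_sep_factor (gT : finGroupType) (pi : nat_pred)
    (G U V : {set gT}) : bool :=
  invariant_factor G U V && (pi.-group (V / U)%g || pi^'.-group (V / U)%g).

(* The series is 1 :: s, so it starts at 1 and ends at G.                     *)
Definition pi_separable (gT : finGroupType) (pi : nat_pred)
    (G : {group gT}) : Prop :=
  exists2 s : seq {group gT},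
    ((pi_sep_factor pi G).-series)%g 1%G s & last 1%G s = G.

Definition pi_elts (gT : finGroupType) (pi : nat_pred) (G : {set gT}) :
    {set gT} := [set x in G | pi.-elt x].

(* A class function on the set G^o = pi_elts pi G is encoded as the element   *)
(* of 'CF(G) that extends it by 0 outside G^o, so that equality in 'CF(G) is  *)
(* equality of functions on G^o; multiplying by the indicator function of G^o *)
(* is restriction to G^o (see picfresE below). With this encoding 'Res[N] is  *)
(* restriction to N^o, and (kappa %% N) * zeta takes the value                *)
(* kappa (g N) * zeta g at every g in G^o and vanishes outside G^o.           *)
Definition picfres (gT : finGroupType) (pi : nat_pred) (G : {group gT})
    (chi : 'CF(G)) : 'CF(G) := '1_(pi_elts pi G) * chi.

(* In the library 0 satisfies [\is a character], hence the clause chi != 0.   *)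
Definition pi_partial_char (gT : finGroupType) (pi : nat_pred)
    (G : {group gT}) (phi : 'CF(G)) : Prop :=
  exists chi : 'CF(G),
    [/\ chi \is a character, chi != 0 & phi = picfres pi chi].

Definition Ipi (gT : finGroupType) (pi : nat_pred) (G : {group gT})
    (phi : 'CF(G)) : Prop :=
  pi_partial_char pi phi /\
  ~ (exists alpha beta : 'CF(G),
       [/\ pi_partial_char pi alpha, pi_partial_char pi beta &
           phi = alpha + beta]).

Lemma picfresE (gT : finGroupType) (pi : nat_pred) (G : {group gT})
    (chi : 'CF(G)) (x : gT) :
  picfres pi chi x = if x \in pi_elts pi G then chi x else 0.
Proof.
rewrite /picfres cfunE cfunElock genGid inE.
have [Gx | _] /= := boolP (x \in G); last by rewrite mul0r.
have ->: (x ^: G \subset pi_elts pi G) = pi.-elt x.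
  apply/subsetP/idP => [/(_ x (class_refl _ _)) | pi_x _ /imsetP[y Gy ->]].
    by rewrite inE => /andP[].
  by rewrite inE groupJ // p_eltJ.
by case: (pi.-elt x); rewrite (mul1r, mul0r).
Qed.

Lemma Res_picfres (gT : finGroupType) (pi : nat_pred) (G N : {group gT})
    (chi : 'CF(G)) :
  N \subset G -> 'Res[N] (picfres pi chi) = picfres pi ('Res[N] chi).
Proof.
move=> sNG; apply/cfun_inP=> x Nx.
by rewrite picfresE !cfResE // picfresE !inE Nx (subsetP sNG).
Qed.

Lemma mul_picfres (gT : finGroupType) (pi : nat_pred) (G N : {group gT})
    (kappa : 'CF(G / N)) (chi : 'CF(G)) (x : gT) :
    N <| G ->
  ((picfres pi kappa %% N)%CF * picfres pi chi) x =
    if x \in pi_elts pi G then kappa (coset N x) * chi x else 0.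
Proof.
move=> nsNG; rewrite cfunE (picfresE pi chi).
case: ifP; rewrite ?mulr0 // inE => /andP[Gx pi_x].
rewrite cfModE // picfresE inE mem_quotient // morph_p_elt //.
exact: (subsetP (normal_norm nsNG)).
Qed.

(* Main.v *)
From HB Require Import structures.
Require Import Defs.
From mathcomp Require Import all_boot all_order all_fingroup all_algebra.
From mathcomp Require Import all_solvable all_field all_character.

(* Write X^o for the restriction to pi-elements.  The key fact is that the    *)
(* irreducible pi-partial characters of a pi-separable group G are linearly   *)
(* independent.  This is proved by induction on |G : Z|, for Z a central      *)
(* pi-subgroup, together with the existence of lifts to Irr(G) with O_pi'(G)  *)
(* in their kernel:                                                           *)
(* - if P = O_pi(G) is not central, one works over each t in Irr(P): if t is  *)
(*   not invariant, the Clifford correspondence reduces to its inertia group; *)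
(*   if it is, t extends to a central extension of G by a pi-group, and       *)
(*   Gallagher's theorem reduces to a group L with a central pi-subgroup Y    *)
(*   such that |L : Y| = |G : P|;                                             *)
(* - if P is central and O_pi'(G) has a proper supplement H in G, every       *)
(*   pi-element of G is conjugate into H, and the lifts for H extend to G;    *)
(* - otherwise Frattini arguments, first on the Sylow subgroups of O_pi'(G)   *)
(*   and then on pi-complements, show that G = O_pi'(G) P.                    *)
(* Now suppose zeta_N = alpha + beta.  The induced partial characters alpha^G *)
(* and beta^G add up to (zeta_N)^G = sum_k kappa_k(1) (kappa_k zeta), so by   *)
(* independence alpha^G = sum_k a_k (kappa_k zeta) with 0 <= a_k; restricting *)
(* to N and inducing again, |G : N| alpha^G is a nonzero multiple of          *)
(* (zeta_N)^G.  Hence zeta is a constituent of alpha^G, and likewise of       *)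
(* beta^G, although its multiplicity in (zeta_N)^G is 1.                      *)

Set Implicit Arguments.
Unset Strict Implicit.
Unset Printing Implicit Defensive.

Import Order.TTheory GRing.Theory Num.Theory.
Local Open Scope group_scope.
Local Open Scope ring_scope.

(** * Extending an invariant character to a central extension *)

(** The argument runs on a decomposition matrix. [pi_basis_exists] provides irreducible characters
    whose restrictions to the pi-elements are linearly independent ([pi_basis_indep]) and include
    every irreducible pi-partial character ([pi_basis_Ipi]), so multiplicities in partial characters
    make sense. [cfInd_cfRes] and [cfInd_Res_Ind] then show that zeta has multiplicity 1 in the
    induced zeta_N and at least 1 in each induced summand, which is absurd. The reductions in the
    existence proof are [pi_basis_inertia], [pi_basis_invariant] and [pi_basis_supplement]. The
    clause on O_pi' in the kernel of the lifts is carried through the induction because the last of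
    these needs it to extend lifts from a supplement. *)

Section CocycleExtension.

Variables (Q : finGroupType) (Z : finZmodType).

(* An alias of Q * Z, which already bears the direct product group structure. *)
Definition cocycle_ext (c : Q -> Q -> Z) : Type := (Q * Z)%type.

Variable c : Q -> Q -> Z.
HB.instance Definition _ := Finite.copy (cocycle_ext c) (Q * Z)%type.

Lemma cocycle_extension :
    (forall x y z, c x y + c (x * y)%g z = c y z + c x (y * z)%g) ->
  exists (hT : finGroupType) (e : Q * Z -> hT),
    bijective e /\
    forall x a y b, (e (x, a) * e (y, b))%g = e ((x * y)%g, a + b + c x y).
Proof.
move=> cP; have c1 z : c 1%g z = c 1%g 1%g.
  by have := cP 1%g 1%g z; rewrite !mul1g => /addIr.
pose T := cocycle_ext c.
pose mul (u v : T) : T := ((u.1 * v.1)%g, u.2 + v.2 + c u.1 v.1).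
(* The cocycle need not be normalised, which accounts for the correction by [c 1 1] here and in
   [inv]. *)
pose one : T := (1%g, - c 1%g 1%g).
pose inv (u : T) : T := (u.1^-1%g, - u.2 - c u.1^-1%g u.1 - c 1%g 1%g).
have mulA : associative mul.
  move=> [x a] [y b] [z d]; rewrite /mul /= mulgA; congr (_, _).
  by rewrite [a + b + _ + d]addrAC -[RHS]addrA cP !addrA.
have mul1 : left_id one mul.
  move=> [x a]; rewrite /mul /one /= mul1g c1; congr (_, _).
  by rewrite addrAC addNr add0r.
have mulV : left_inverse one inv mul.
  move=> [x a]; rewrite /mul /one /= mulVg; congr (_, _).
  by rewrite addrAC (addrAC _ _ (c _ x)) subrK addrAC addNr add0r.
pose gm := Finite_isGroup.Build T mulA mul1 mulV.
pose hT : finGroupType := HB.pack T gm.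
by exists hT, (fun u => u : hT); split=> //; exists (fun u => u).
Qed.

End CocycleExtension.

Lemma centralising_scalar (gT : finGroupType) (P : {group gT}) (t : Iirr P) A :
  (forall m, m \in P -> A *m 'Chi_t m = 'Chi_t m *m A) -> exists s, A = s%:M.
Proof.
move=> cA; apply/is_scalar_mxP; apply: (mx_abs_irr_cent_scalar (rG := 'Chi_t)).
  exact/groupC/socle_irr.
by apply/centgmxP.
Qed.

(** Conjugating ['Chi_t] by x leaves its character unchanged, hence gives a similar representation.
    Scaling the similarity by a root of the inverse determinant makes the determinant 1. *)
Lemma invariant_irr_intertwiner (gT : finGroupType) (G P : {group gT})
    (t : Iirr P) x :
    P <| G -> G \subset 'I['chi_t] -> x \in G ->
  exists2 A, \det A = 1 &
    forall m, m \in P -> A *m 'Chi_t m = 'Chi_t (m ^ x^-1)%g *m A.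
Proof.
move=> nsPG IGt Gx; have nPG := subsetP (normal_norm nsPG).
pose r m := 'Chi_t (m ^ x^-1)%g.
have memJ m : m \in P -> (m ^ x^-1)%g \in P by rewrite memJ_norm // groupV nPG.
have rP : mx_repr P r.
  split=> [|m1 m2 Pm1 Pm2]; first by rewrite /r conj1g repr_mx1.
  by rewrite /r conjMg repr_mxM ?memJ.
have rt : cfRepr (MxRepresentation rP) = cfRepr 'Chi_t.
  apply/cfun_inP=> m Pm; rewrite irrRepr cfunE Pm /=.
  have := congr1 (fun phi : 'CF(P) => phi m) (inertiaJ (subsetP IGt _ Gx)).
  rewrite cfConjgE ?nPG // => <-.
  by rewrite -[in RHS]irrRepr [RHS]cfunE memJ.
have [B [B' B'B /= Br]] := mx_rsim_def (cfRepr_inj rt).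
have dBB' : \det B' * \det B = 1 by rewrite -det_mulmx B'B det1.
have dB'_neq0 : \det B' != 0.
  by apply: contra_eq_neq dBB' => ->; rewrite mul0r eq_sym oner_eq0.
have dB_neq0 : \det B != 0.
  by apply: contra_eq_neq dBB' => ->; rewrite mulr0 eq_sym oner_eq0.
have n_gt0 : (0 < irr_degree (socle_of_Iirr t))%N by apply: irr_degree_gt0.
exists ((irr_degree (socle_of_Iirr t)).-root (\det B)^-1 *: B).
  by rewrite detZ rootCK // mulVf.
move=> m Pm; rewrite -scalemxAl -scalemxAr; congr (_ *: _).
by rewrite [X in _ = X *m B]Br // -mulmxA B'B mulmx1.
Qed.

(* Some intertwiners A x of determinant 1 represent G projectively, with a     *)
(* cocycle of (#|P|^2)-th roots of unity; hT is the corresponding extension,   *)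
(* and Q consists of the pairs (y, 'Chi_t y) for y in P.                       *)
Lemma invariant_irr_central_extension (gT : finGroupType) (G P : {group gT})
    (t : Iirr P) :
    P <| G -> G \subset 'I['chi_t] ->
  exists (hT : finGroupType) (f : {morphism [set: hT] >-> gT})
         (Q : {group hT}) (u : Iirr [set: hT]),
    [/\ [/\ f @* [set: hT] = G, 'ker f \subset 'Z([set: hT])
          & #|'ker f| = (#|P| ^ 2)%N],
        [/\ Q <| [set: hT], 'ker f :&: Q = 1%g & f @* Q = P],
        'Res[Q] 'chi_u \in irr Q /\ {in Q, forall y, 'chi_u y = 'chi_t (f y)}
      & {in 'C(Q), forall y, coprime #[y] #|P| -> 'chi_u y = 'chi_u 1%g}].
Proof.
move=> nsPG IGt; have [sPG nPG] := andP nsPG.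
pose n := irr_degree (socle_of_Iirr t).
have n_gt0 : (0 < n)%N by apply: irr_degree_gt0.
have dv_n : (n %| #|P|)%N by have := dvd_irr1_cardG t; rewrite irr1_degree dvdC_nat.
have [R [RM R1 trR cR exA]] : exists R : gT -> 'M[algC]_n,
  [/\ {in P &, {morph R : x y / (x * y)%g >-> x *m y}}, R 1%g = 1%:M,
      {in P, forall m, 'chi_t m = \tr (R m)},
      forall A, (forall m, m \in P -> A *m R m = R m *m A) -> exists s, A = s%:M
    & forall x, x \in G -> exists2 A, \det A = 1 &
        forall m, m \in P -> A *m R m = R (m ^ x^-1)%g *m A].
  exists (repr_mx 'Chi_t); split; [exact: repr_mxM | exact: repr_mx1 | | | ].
  - by move=> m Pm; rewrite -irrRepr cfunE Pm.
  - exact: centralising_scalar.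
  - by move=> x; apply: invariant_irr_intertwiner.
(* Two intertwiners over the same x differ by a scalar s. If their determinants are |P|-th roots of
   unity, then s ^ (n |P|) = 1, and n divides |P|; so the |P|^2-th roots of unity contain every
   scalar that occurs. *)
have [N' defN] : exists N', (#|P| ^ 2)%N = N'.+1.
  by exists (#|P| ^ 2).-1; rewrite prednK // expn_gt0 cardG_gt0.
have [w w_prim] := C_prim_root_exists (ltn0Sn N').
have dv_nP_N : (n * #|P| %| N'.+1)%N by rewrite -defN expnS expn1 dvdn_mul.
have /fin_all_exists2[A dA RA] (x : subg_of G) :
    exists2 A : 'M[algC]_n, \det A = 1
      & forall m, m \in P -> A *m R m = R (m ^ (sgval x)^-1)%g *m A.
  exact/exA/subgP.
have uA x : A x \in unitmx by rewrite unitmxE dA unitr1.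
pose M (x : subg_of G) (a : 'I_N'.+1) := w ^+ a *: A x.
have MR x a m : m \in P -> M x a *m R m = R (m ^ (sgval x)^-1)%g *m M x a.
  by move=> Pm; rewrite -scalemxAl -scalemxAr RA.
have dM x a : \det (M x a) = w ^+ (a * n) by rewrite detZ dA mulr1 exprM.
have M_inj x a b : M x a = M x b -> a = b.
  rewrite /M => /(congr1 (mulmx^~ (invmx (A x)))).
  rewrite -!scalemxAl mulmxV // => /matrixP/(_ (Ordinal n_gt0) (Ordinal n_gt0)).
  rewrite !mxE eqxx !mulr1 => /eqP; rewrite (eq_prim_root_expr w_prim).
  by rewrite !modn_small // => /eqP/val_inj.
have exM x B : (forall m, m \in P -> B *m R m = R (m ^ (sgval x)^-1)%g *m B) ->
    \det B ^+ #|P| = 1 -> exists a, B = M x a.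
  move=> BR dB; have [|s defs] := cR (invmx (A x) *m B).
    move=> m Pm; rewrite -mulmxA BR // !mulmxA; congr (_ *m _).
    by apply: (canRL (mulmxK (uA x))); rewrite -mulmxA -RA // mulKmx.
  have defB : B = s *: A x by rewrite -[B](mulKVmx (uA x)) defs mul_mx_scalar.
  have s1 : s ^+ N'.+1 = 1.
    have /dvdnP[q ->] := dv_nP_N; rewrite mulnC exprM exprM.
    by move: dB; rewrite defB detZ dA mulr1 => ->; rewrite expr1n.
  by have [a wa] := prim_rootP w_prim s1; exists a; rewrite defB wa.
have [k Mk] : exists k : {ffun subg_of G * subg_of G -> 'I_N'.+1},
    forall x y, A x *m A y = M (x * y)%g (k (x, y)).
  have /fin_all_exists[k Mk] (xy : subg_of G * subg_of G) :
      exists a, A xy.1 *m A xy.2 = M (xy.1 * xy.2)%g a.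
    apply: exM => [m Pm|]; last by rewrite det_mulmx !dA mulr1 expr1n.
    rewrite -mulmxA RA // mulmxA RA ?mulmxA.
      by rewrite -conjgM -invMg.
    by rewrite memJ_norm // groupV (subsetP nPG) ?subgP.
  by exists [ffun xy => k xy] => x y; rewrite ffunE (Mk (x, y)).
have wD (a b : 'I_N'.+1) : w ^+ (a + b)%R = w ^+ a * w ^+ b.
  by rewrite /= (prim_expr_mod w_prim) exprD.
have MM x y a b : M x a *m M y b = M (x * y)%g (a + b + k (x, y)).
  by rewrite -scalemxAl -scalemxAr Mk /M !scalerA !wD.
(* The cocycle identity is associativity of the matrix product. *)
have kP x y z : k (x, y) + k (x * y, z)%g = k (y, z) + k (x, y * z)%g.
  have := mulmxA (M x 0) (M y 0) (M z 0).
  by rewrite !MM mulgA => /M_inj; rewrite !(addr0, add0r).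
have [hT [e [[g eK gK] eM]]] := cocycle_extension (c := fun x y => k (x, y)) kP.
have gM h1 h2 : g (h1 * h2)%g =
    (((g h1).1 * (g h2).1)%g, (g h1).2 + (g h2).2 + k ((g h1).1, (g h2).1)).
  rewrite -{1}(gK h1) -{1}(gK h2); case: (g h1) (g h2) => x a [y b].
  by rewrite eM eK.
pose f0 h := sgval (g h).1; pose E h := M (g h).1 (g h).2.
have f0M : {in [set: hT] &, {morph f0 : x y / (x * y)%g}}.
  by move=> h1 h2 _ _; rewrite /f0 gM morphM ?inE.
pose f := Morphism f0M.
have fE h : f h \in G by apply: subgP.
have EM : {in [set: hT] &, {morph E : x y / (x * y)%g >-> x *m y}}.
  by move=> h1 h2 _ _; rewrite /E gM MM.
have f_inj h1 h2 : f h1 = f h2 -> E h1 = E h2 -> h1 = h2.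
  move=> /val_inj eq1 eqE; apply: (can_inj gK); move: eq1 eqE; rewrite /E.
  by case: (g h1) (g h2) => x a [y b] /= -> /M_inj->.
have ER h m : m \in P -> E h *m R m = R (m ^ (f h)^-1)%g *m E h by apply: MR.
have w_neq0 : w != 0.
  apply/eqP=> w0; have := prim_expr_order w_prim; rewrite w0 expr0n => /eqP.
  by rewrite eq_sym oner_eq0.
have E1 : E 1%g = 1%:M.
  have uE : E 1%g \in unitmx by rewrite unitmxE dM unitfE expf_neq0.
  by rewrite -[RHS](mulmxV uE) -{2}[1%g]mulg1 EM ?inE // mulmxK.
pose rE := MxRepresentation (conj E1 EM : mx_repr [set: hT] E).
have exE x B : x \in G -> (forall m, m \in P -> B *m R m = R (m ^ x^-1)%g *m B) ->
    \det B ^+ #|P| = 1 -> exists2 h, f h = x & E h = B.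
  move=> Gx BR dB; have [] := exM (subg G x) B _ dB; rewrite ?subgK //.
  by move=> a ->; exists (e (subg G x, a)); rewrite /= /f0 /E eK ?subgK.
(* The matrix [R m] is itself an intertwiner for m, and its determinant is a |P|-th root of unity
   since m ^+ #|P| = 1. *)
have exR m : m \in P -> exists2 h, f h = m & E h = R m.
  move=> Pm; apply: exE; first exact: (subsetP sPG).
    move=> m1 Pm1; rewrite -!RM ?memJ_norm ?groupV ?(subsetP (normG P)) //.
    by rewrite conjgE invgK -!mulgA mulVg mulg1.
  have detR q : \det (R (m ^+ q)%g) = \det (R m) ^+ q.
    elim: q => [|q IHq]; first by rewrite expg0 R1 det1.
    by rewrite expgS RM ?groupX // det_mulmx IHq exprS.
  by rewrite -detR expg_cardG // R1 det1.
pose Qset := [set h | (f h \in P) && (E h == R (f h))].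
have Qgroup : group_set Qset.
  apply/group_setP; split=> [|h1 h2].
    by rewrite inE morph1 group1 E1 R1 eqxx.
  rewrite !inE => /andP[P1 /eqP E_1] /andP[P2 /eqP E_2].
  by rewrite EM ?inE // morphM ?inE // groupM // E_1 E_2 RM ?eqxx.
have [Q inQ] : exists Q : {group hT},
    forall h, (h \in Q) = (f h \in P) && (E h == R (f h)).
  by exists (Group Qgroup) => h; rewrite inE.
have QE h : h \in Q -> f h \in P /\ E h = R (f h).
  by rewrite inQ => /andP[Ph /eqP Eh]; split.
have ker1 h : h \in 'ker f -> f h = 1%g by case/morphpreP=> _ /set1P.
have chE h : cfRepr rE h = \tr (E h) by rewrite cfunE inE.
have injf : {in Q &, injective f}.
  move=> h1 h2 /QE[_ E_1] /QE[_ E_2] eqf.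
  by apply: f_inj; rewrite // E_1 E_2 eqf.
have imf : f @: Q = P.
  apply/setP=> x; apply/imsetP/idP=> [[h /QE[Ph _] -> //]|Px].
  by have [h fh Eh] := exR x Px; exists h; rewrite // inQ fh Px Eh eqxx.
have cardQ : #|Q| = #|P| by rewrite -imf card_in_imset.
have resQ : 'Res[Q] (cfRepr rE) \in irr Q.
  rewrite irrEchar cfRes_char ?cfRepr_char //=.
  have sumP F : \sum_(x in P) F x = \sum_(h in Q) F (f h) :> algC.
    by rewrite -imf big_imset.
  apply/eqP; transitivity '['chi_t]; last exact: cfnorm_irr.
  rewrite !cfdotE cardQ sumP; congr (_ * _).
  apply: eq_bigr => h Qh; have [Ph Eh] := QE h Qh.
  by rewrite cfResE ?subsetT // chE trR // Eh.
have /irrP[u defu] : cfRepr rE \in irr [set: hT].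
  exact: cfRes_irr_irr (cfRepr_char rE) resQ.
have imT : f @* [set: hT] = G.
  apply/eqP; rewrite eqEsubset; apply/andP; split; apply/subsetP=> x.
    by case/morphimP=> h _ _ ->.
  move=> Gx; have [A1 dA1 RA1] := exA x Gx.
  have [|h <- _] := exE x A1 Gx RA1; first by rewrite dA1 expr1n.
  by rewrite mem_morphim ?inE.
exists hT, f, Q, u; split.
- split=> //.
  + apply/subsetP=> h /ker1 fh1; apply/centerP; split=> [|h' _]; first by rewrite inE.
    have [s Es] : exists s, E h = s%:M.
      by apply: cR => m Pm; rewrite ER // fh1 invg1 conjg1.
    apply: f_inj; first by rewrite !morphM ?inE // fh1 mulg1 mul1g.
    by rewrite !EM ?inE // Es scalar_mxC.
  + have : #|[set: hT]| = (#|G| * N'.+1)%N.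
      by rewrite cardsT -(bij_eq_card (Bijective eK gK)) card_prod card_ord card_sub.
    rewrite -(Lagrange (subsetT ('ker f))) -[#|_ : _|]/(#|setT : 'ker f|)%N.
    have <- : #|f @* [set: hT]| = #|[set: hT] : 'ker f|.
      by rewrite card_morphim setTI.
    by rewrite imT defN mulnC => /eqP; rewrite eqn_pmul2l // => /eqP.
- split.
  + rewrite /normal subsetT; apply/subsetP=> h' _; rewrite inE.
    apply/subsetP=> _ /imsetP[h /QE[Ph Eh] ->]; rewrite inQ morphJ ?inE //.
    have Pfh : (f h ^ f h')%g \in P by rewrite memJ_norm // (subsetP nPG).
    rewrite Pfh; apply/eqP; rewrite [(h ^ h')%g]conjgE !EM ?inE // Eh mulmxA.
    rewrite ER // morphV ?inE // invgK.
    by rewrite -mulmxA -EM ?inE // mulVg E1 mulmx1.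
  + apply/trivgP/subsetP=> h /setIP[/ker1 fh1 /QE[_ Eh]]; rewrite inE.
    by apply/eqP/f_inj; rewrite ?morph1 // E1 Eh fh1.
  + by rewrite morphimEsub ?subsetT.
- by split=> [|h /QE[Ph Eh]]; rewrite -defu // chE Eh trR.
move=> h cQh co_h; rewrite -defu !chE E1.
(* By Schur, h acts as a scalar s. The order of s divides that of h and also n |P|^2, by
   determinants; these are coprime, so s = 1. *)
have [s Es] : exists s, E h = s%:M.
  apply: cR => m Pm; have [h' fh' Eh'] := exR m Pm.
  rewrite -Eh' -!EM ?inE //; congr (E _); apply: (centP cQh).
  by rewrite inQ fh' Pm Eh' eqxx.
have Eq q : E (h ^+ q)%g = (s ^+ q)%:M.
  elim: q => [|q IHq]; first by rewrite expg0 E1.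
  by rewrite expgS EM ?inE // IHq Es -scalar_mxM exprS.
have sh1 : s ^+ #[h] = 1.
  have := Eq #[h]; rewrite expg_order E1.
  by move/matrixP/(_ (Ordinal n_gt0) (Ordinal n_gt0)); rewrite !mxE eqxx.
have sN1 : s ^+ (n * N'.+1) = 1.
  rewrite exprM.
  have <- : \det (s%:M : 'M[algC]_n) = s ^+ n by rewrite det_scalar.
  rewrite -Es dM -exprM mulnC exprM.
  by rewrite (prim_expr_order w_prim) expr1n.
have [m s_prim dvmh] := prim_order_exists (order_gt0 h) sh1.
suffices m1 : m = 1%N by move: (prim_expr_order s_prim); rewrite m1 expr1 Es => ->.
apply/eqP; rewrite -dvdn1 -(eqP (_ : coprime m (n * N'.+1))).
  by rewrite dvdn_gcd dvdnn (prim_order_dvd s_prim) sN1 eqxx.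
apply: coprime_dvdl dvmh _; rewrite coprimeMr -defN coprimeXr // andbT.
exact: coprime_dvdr dv_n co_h.
Qed.

(** * Bases of pi-partial characters *)

Lemma picfres_on (gT : finGroupType) pi (G : {group gT}) (phi : 'CF(G)) :
  (phi \in 'CF(G, pi_elts pi G)) = (picfres pi phi == phi).
Proof.
apply/cfun_onP/eqP=> [phi0 | <- x /negPf nx]; last by rewrite picfresE nx.
by apply/cfunP=> x; rewrite picfresE; case: ifPn => // /phi0.
Qed.

Lemma picfres_sum (gT : finGroupType) pi (G : {group gT}) (I : finType)
    (A : {pred I}) (phi : I -> 'CF(G)) (d : I -> nat) :
  picfres pi (\sum_(i in A) phi i *+ d i) = \sum_(i in A) picfres pi (phi i) *+ d i.
Proof. by rewrite /picfres mulr_sumr; apply: eq_bigr => i _; rewrite mulrnAr. Qed.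

Lemma picfres_Ind (gT : finGroupType) pi (G H : {group gT}) (phi : 'CF(H)) :
  H \subset G -> 'Ind[G] (picfres pi phi) = picfres pi ('Ind[G] phi).
Proof.
move=> sHG; rewrite [RHS]mulrC -cfIndM // mulrC; congr ('Ind _).
apply/cfun_inP=> x Hx.
have := Res_picfres pi 1 sHG; rewrite /picfres !mulr1 => ->.
by rewrite rmorph1 mulr1 mulrC.
Qed.

(* B indexes lifts of the irreducible pi-partial characters "belonging to" A,  *)
(* and d is the decomposition matrix.  The first two clauses say that the      *)
(* columns of d give characters, vanishing off the pi-elements, that are dual  *)
(* to the restrictions of the 'chi_i for i in B, which are thus independent.   *)
Definition pi_basis (gT : finGroupType) (pi : nat_pred) (G : {group gT})
    (A B : {set Iirr G}) : Prop :=
  B \subset A /\ exists d : Iirr G -> Iirr G -> nat,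
    [/\ {in B, forall i, \sum_(j in A) 'chi_j *+ d j i \in 'CF(G, pi_elts pi G)},
        {in B &, forall i j, d j i = (j == i)},
        {in A, forall j,
          picfres pi 'chi_j = \sum_(i in B) picfres pi 'chi_i *+ d j i}
      & {in B, forall i, 'O_pi^'(G) \subset cfker 'chi_i}].

Lemma pi_basis0 (gT : finGroupType) pi (G : {group gT}) :
  pi_basis pi (set0 : {set Iirr G}) set0.
Proof.
by split=> //; exists (fun _ _ => 0%N); split=> [i|i j|j|i]; rewrite inE.
Qed.

(** The decomposition matrix of the union is block diagonal. *)
Lemma pi_basisU (gT : finGroupType) pi (G : {group gT}) (A1 B1 A2 B2 : {set Iirr G}) :
    [disjoint A1 & A2] -> pi_basis pi A1 B1 -> pi_basis pi A2 B2 ->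
  pi_basis pi (A1 :|: A2) (B1 :|: B2).
Proof.
move=> dA [sB1 [d1 [a1 b1 c1 k1]]] [sB2 [d2 [a2 b2 c2 k2]]].
have notA12 j : j \in A1 -> j \in A2 = false by apply: (disjointFr dA).
have notA21 j : j \in A2 -> j \in A1 = false by apply: (disjointFl dA).
have dB : [disjoint B1 & B2].
  by apply: disjointWl sB1 (disjointWr sB2 dA).
split; first exact: setUSS.
have sumU (U1 U2 : {set Iirr G}) (F : Iirr G -> 'CF(G)) : [disjoint U1 & U2] ->
    \sum_(i in U1 :|: U2) F i = \sum_(i in U1) F i + \sum_(i in U2) F i.
  by move=> dU; rewrite -bigU //=; apply: eq_bigl => i; rewrite !inE.
pose d j i := if (j \in A1) && (i \in A1) then d1 j i else
              if (j \in A2) && (i \in A2) then d2 j i else 0%N.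
have d11 j i : j \in A1 -> i \in A1 -> d j i = d1 j i by rewrite /d => -> ->.
have d22 j i : j \in A2 -> i \in A2 -> d j i = d2 j i.
  by move=> Aj Ai; rewrite /d notA21 // Aj Ai.
have d12 j i : j \in A1 -> i \in A2 -> d j i = 0%N.
  by move=> Aj Ai; rewrite /d (notA21 i) // andbF notA12.
have d21 j i : j \in A2 -> i \in A1 -> d j i = 0%N.
  by move=> Aj Ai; rewrite /d (notA21 j) // (notA12 i) ?andbF.
exists d; split=> [i|i j|j|i].
- case/setUP=> Bi; rewrite sumU //.
    have Ai := subsetP sB1 i Bi.
    rewrite [X in _ + X]big1 => [|j Aj]; last by rewrite d21.
    by rewrite addr0 (eq_bigr _ (fun j Aj => congr1 _ (d11 j i Aj Ai))) a1.
  have Ai := subsetP sB2 i Bi.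
  rewrite [X in X + _]big1 => [|j Aj]; last by rewrite d12.
  by rewrite add0r (eq_bigr _ (fun j Aj => congr1 _ (d22 j i Aj Ai))) a2.
- have neq12 (i1 i2 : Iirr G) : i1 \in A1 -> i2 \in A2 -> (i1 == i2) = false.
    by move=> Ai1; apply: contraTF => /eqP <-; rewrite notA12.
  case/setUP=> Bi /setUP[] Bj.
  + by rewrite d11 ?b1 // (subsetP sB1).
  + by rewrite d21 ?(eq_sym j) ?neq12 ?(subsetP sB1 i) ?(subsetP sB2 j).
  + by rewrite d12 ?neq12 ?(subsetP sB1 j) ?(subsetP sB2 i).
  by rewrite d22 ?b2 // (subsetP sB2).
- case/setUP=> Aj; rewrite sumU //.
    rewrite [X in _ + X]big1 => [|i Bi]; last by rewrite d12 ?(subsetP sB2 i).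
    by rewrite addr0 c1 //; apply: eq_bigr => i Bi; rewrite d11 ?(subsetP sB1 i).
  rewrite [X in X + _]big1 => [|i Bi]; last by rewrite d21 ?(subsetP sB1 i).
  by rewrite add0r c2 //; apply: eq_bigr => i Bi; rewrite d22 ?(subsetP sB2 i).
by case/setUP=> Bi; [apply: k1 | apply: k2].
Qed.

(** * Clifford theory: splitting a basis over a normal subgroup *)

(** By Clifford, s and t are conjugate in G when they lie under a common character. Hence the sets
    of characters over two such indices are equal or disjoint. *)
Lemma irr_constt_Ind_eq (gT : finGroupType) (G P : {group gT}) (s t : Iirr P) j :
    P <| G -> j \in irr_constt ('Ind[G] 'chi_s) -> j \in irr_constt ('Ind[G] 'chi_t) ->
  'Ind[G] 'chi_s = 'Ind[G] 'chi_t.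
Proof.
move=> nsPG; rewrite !constt_Ind_Res => sj.
rewrite [_ \in _]irr_consttE (Clifford_Res_sum_cfclass nsPG sj) => tj.
apply: cfclass_Ind => //; apply: contraR tj => nst; apply/eqP.
rewrite cfdotZl cfdot_suml big1_seq ?mulr0 // => chi /=.
case/cfclassP=> y Gy def_chi; rewrite def_chi -conjg_IirrE cfdot_irr.
case: eqP => // def_t; case/negP: nst; rewrite -def_t conjg_IirrE.
by apply/cfclassP; exists y.
Qed.

Lemma pi_basis_glue (gT : finGroupType) pi (G P : {group gT}) :
    P <| G ->
    (forall t : Iirr P, exists B, pi_basis pi [set j in irr_constt ('Ind[G] 'chi_t)] B) ->
  exists B, pi_basis pi [set: Iirr G] B.
Proof.
move=> nsPG basisP; have [sPG nPG] := andP nsPG.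
pose A (t : Iirr P) := [set j in irr_constt ('Ind[G] 'chi_t)].
have union (s : seq (Iirr P)) : exists B, pi_basis pi (\bigcup_(t <- s) A t) B.
  elim: s => [|t s [B2 basB2]]; first by exists set0; rewrite big_nil; apply: pi_basis0.
  rewrite big_cons; have [B1 basB1] := basisP t.
  (* If the set over t meets the union, it equals one of its members and adds nothing. *)
  have [dAs | ] := boolP [disjoint A t & \bigcup_(t <- s) A t].
    by exists (B1 :|: B2); apply: pi_basisU.
  case/pred0Pn=> j /andP[/= Atj]; rewrite bigcup_seq => /bigcupP[r sr Arj].
  rewrite bigcup_seq in basB2.
  exists B2; rewrite (setUidPr _) // (bigcup_max r) //.
  rewrite /A (@irr_constt_Ind_eq _ G P t r j) //; first by move: Atj; rewrite inE.
  by move: Arj; rewrite inE.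
have [B basB] := union (enum (Iirr P)); exists B.
suffices -> : [set: Iirr G] = \bigcup_(t <- enum (Iirr P)) A t by [].
apply/setP=> j; rewrite inE bigcup_seq; apply/esym/bigcupP.
have [t tj] := constt_cfRes_irr P j.
by exists t; rewrite ?mem_enum // inE constt_Ind_Res.
Qed.

Lemma picfres_pgroup (gT : finGroupType) pi (P : {group gT}) (phi : 'CF(P)) :
  pi.-group P -> picfres pi phi = phi.
Proof.
move=> piP; apply/eqP; rewrite -picfres_on; apply: (cfun_onS (B := P)).
  by apply/subsetP=> x Px; rewrite inE Px (mem_p_elt piP).
exact: cfun_onG.
Qed.

(** On a pi-group P, restriction to pi-elements loses nothing, so the decomposition of each ['chi_j]
    becomes an identity of characters of P. A nonzero [d j i] thus forces i and j to lie over the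
    same class of characters of P, and the matrix splits into blocks. *)
Lemma pi_basis_restrict (gT : finGroupType) pi (G P : {group gT}) (t : Iirr P)
    (A B : {set Iirr G}) (C := [set j in irr_constt ('Ind[G] 'chi_t)]) :
    P <| G -> pi.-group P -> pi_basis pi A B ->
  pi_basis pi (A :&: C) (B :&: C).
Proof.
move=> nsPG piP [sBA [d [dA dB dR dK]]]; have [sPG _] := andP nsPG.
have inC j : (j \in C) = (t \in irr_constt ('Res 'chi_j)).
  by rewrite inE constt_Ind_Res.
have ResP j : j \in A -> 'Res[P] 'chi_j = \sum_(i in B) 'Res[P] 'chi_i *+ d j i.
  move=> Aj; rewrite -[LHS](picfres_pgroup _ piP) -Res_picfres // dR //.
  rewrite linear_sum; apply: eq_bigr => i _.
  by rewrite raddfMn /= Res_picfres // picfres_pgroup.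
have constt_d j i s : j \in A -> i \in B -> d j i != 0%N ->
    s \in irr_constt ('Res[P] 'chi_i) -> s \in irr_constt ('Res[P] 'chi_j).
  move=> Aj Bi dji; rewrite !irr_consttE (ResP j) // cfdot_suml => si.
  apply: contra si => /eqP Sj0.
  have /(_ _ i Bi)/eqP := psumr_eq0P _ Sj0.
  rewrite cfdotMnl mulrn_eq0 (negPf dji) /=; apply => k _.
  rewrite cfdotMnl mulrn_wge0 // natr_ge0 //.
  by rewrite Cnat_cfdot_char ?cfRes_char ?irr_char.
have dC j i : j \in A -> i \in B -> d j i != 0%N -> (j \in C) = (i \in C).
  move=> Aj Bi dji; apply/idP/idP; last by rewrite !inC; apply: constt_d.
  have [s si] := constt_cfRes_irr P i => Cj.
  have := constt_d j i s Aj Bi dji si; rewrite -constt_Ind_Res => sj.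
  move: Cj; rewrite !in_set => tj; rewrite (irr_constt_Ind_eq nsPG tj sj).
  by rewrite constt_Ind_Res.
have sum_d (U : {set Iirr G}) (F : Iirr G -> 'CF(G)) e :
    (forall i, i \in U -> i \notin C -> e i = 0%N) ->
  \sum_(i in U) F i *+ e i = \sum_(i in U :&: C) F i *+ e i.
  move=> e0; rewrite (big_setID C) /= [X in _ + X]big1 ?addr0 // => i.
  by case/setDP=> Ui nCi; rewrite e0.
split; first exact: setSI.
exists d; split=> [i /setIP[Bi Ci] | i j /setIP[Bi _] /setIP[Bj _] | j /setIP[Aj Cj] | i /setIP[Bi _]].
- rewrite -sum_d ?dA // => j Aj nCj; apply: contraNeq nCj => dji.
  by rewrite (dC j i).
- exact: dB.
- rewrite dR // sum_d // => i Bi nCi; apply: contraNeq nCi => dji.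
  by rewrite -(dC j i).
exact: dK.
Qed.

(** * Transport of bases along induction, products and inflation *)

(** All identities are compared in the common target ['CF(M)]. Either [L] or [L'] is the identity in
    each use, so the correspondence of characters may run in either direction. *)
Lemma pi_basis_transfer (gT rT mT : finGroupType) pi (G : {group gT})
    (H : {group rT}) (M : {group mT}) (A B : {set Iirr H}) (h : Iirr H -> Iirr G)
    (L : {additive 'CF(H) -> 'CF(M)}) (L' : {additive 'CF(G) -> 'CF(M)}) :
    pi_basis pi A B -> {in A &, injective h} ->
    {in A, forall j, L' 'chi_(h j) = L 'chi_j} -> injective L' ->
    (forall phi, L (picfres pi phi) = picfres pi (L phi)) ->
    (forall phi, L' (picfres pi phi) = picfres pi (L' phi)) ->
    {in B, forall i, 'O_pi^'(H) \subset cfker 'chi_i ->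
                     'O_pi^'(G) \subset cfker 'chi_(h i)} ->
  pi_basis pi (h @: A) (h @: B).
Proof.
move=> [sBA [d [dA dB dR dK]]] inj_h defL injL' L_pi L'_pi kerh.
have sBA' := subsetP sBA; split; first exact: imsetS.
pose g j := odflt 0 [pick i in A | h i == j].
have hK : {in A, cancel h g}.
  move=> i Ai; rewrite /g; case: pickP => [k /andP[Ak /eqP/inj_h->] // | /(_ i)].
  by rewrite Ai eqxx.
exists (fun j i => d (g j) (g i)); split.
- move=> _ /imsetP[i Bi ->]; rewrite picfres_on; apply/eqP/injL'.
  rewrite L'_pi big_imset //= raddf_sum /=.
  have -> : \sum_(j in A) L' ('chi_(h j) *+ d (g (h j)) (g (h i))) =
            L (\sum_(j in A) 'chi_j *+ d j i).
    rewrite raddf_sum; apply: eq_bigr => j Aj.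
    by rewrite !raddfMn /= defL // !hK // sBA'.
  by rewrite -L_pi; congr (L _); apply/eqP; rewrite -picfres_on dA.
- move=> _ _ /imsetP[i Bi ->] /imsetP[j Bj ->].
  by rewrite !hK ?sBA' // dB // (inj_in_eq inj_h) ?sBA'.
- move=> _ /imsetP[j Aj ->]; apply: injL'.
  rewrite L'_pi defL // -L_pi dR // big_imset /=; last exact: sub_in2 inj_h.
  rewrite !raddf_sum; apply: eq_bigr => i Bi.
  by rewrite !raddfMn /= L_pi L'_pi defL ?hK // sBA'.
by move=> _ /imsetP[i Bi ->]; apply/kerh/dK.
Qed.

Lemma coprime_normal_cents (gT : finGroupType) (G H K : {group gT}) :
  H <| G -> K <| G -> coprime #|H| #|K| -> H \subset 'C(K).
Proof.
move=> /andP[sHG nHG] /andP[sKG nKG] coHK; apply/commG1P/trivgP.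
rewrite -(coprime_TIg coHK) commg_subI // subsetI ?subxx /=.
  exact: subset_trans nKG.
exact: subset_trans nHG.
Qed.

(** This transports along the Clifford correspondence. O_pi'(G) centralises P, so it lies in O_pi'
    of the inertia group; being normal in G, it stays in the kernel after induction. *)
Lemma pi_basis_inertia (gT : finGroupType) pi (G P : {group gT}) (t : Iirr P) :
    P <| G -> pi.-group P ->
    (exists B, pi_basis pi [set: Iirr 'I_G['chi_t]] B) ->
  exists B, pi_basis pi [set j in irr_constt ('Ind[G] 'chi_t)] B.
Proof.
move=> nsPG piP [B basB]; have [sPG nPG] := andP nsPG.
have sTG : 'I_G['chi_t] \subset G := subsetIl _ _.
have [irrT injT imT _ _] := constt_Inertia_bijection t nsPG.
have := pi_basis_restrict t (normal_Inertia _ sPG) piP basB.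
rewrite setTI; set AT := [set j in _]; set BT := B :&: _ => basT.
have -> : [set j in irr_constt ('Ind[G] 'chi_t)] = Ind_Iirr G @: AT.
  apply/setP=> j; rewrite in_set -imT; apply/imsetP/imsetP=> [] [i iT ->].
    by exists i; rewrite ?in_set.
  by exists i; rewrite // in_set in iT.
exists (Ind_Iirr G @: BT).
have IndE : {in AT, forall j, 'chi_(Ind_Iirr G j) = 'Ind[G] 'chi_j}.
  by move=> j; rewrite in_set => /irrT irrj; rewrite cfIirrE.
apply: (pi_basis_transfer (L := 'Ind[G]) (L' := idfun)) basT _ _ _ _ _ _ => //.
- by move=> i j; rewrite !in_set; apply: injT.
- by move=> phi; apply: picfres_Ind.
move=> i Bi kerT; rewrite IndE; last by move: Bi; case/setIP.
have nsKG : 'O_pi^'(G) <| G := pcore_normal _ _.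
rewrite cfker_Ind_irr // sub_gcore ?(normal_norm nsKG) //.
apply: subset_trans kerT; apply: pcore_max; first exact: pcore_pgroup.
apply: (normalS _ _ nsKG) => //; apply: subset_trans (cent_sub_Inertia _ _).
rewrite subsetI normal_sub //= (coprime_normal_cents nsKG nsPG) //.
by rewrite coprime_sym; apply: pnat_coprime piP (pcore_pgroup _ _).
Qed.

Lemma irr_factor_morphim (aT rT : finGroupType) (D H : {group aT}) (R : {group rT})
    (f : {morphism D >-> rT}) (i : Iirr H) :
    H \subset D -> f @* H = R -> 'ker_H f \subset cfker 'chi_i ->
  exists k : Iirr R, {in H, forall x, 'chi_k (f x) = 'chi_i x}.
Proof.
move=> sHD defR kerH; have [h injh im_h] := first_isom_loc f sHD.
have nsKH : 'ker_H f <| H.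
  by rewrite /normal subsetIl normsI ?normG // (subset_trans sHD) ?ker_norm.
have isoh : isom (H / 'ker_H f) R h by apply/isomP; rewrite im_h.
have /irrP[k defk] : cfIsom isoh ('chi_i / 'ker_H f)%CF \in irr R.
  by rewrite cfIsom_irr cfQuo_irr ?mem_irr.
exists k => x Hx; rewrite -defk.
have -> : f x = h (coset ('ker_H f) x).
  have Dx := subsetP sHD x Hx; have nx := subsetP (normal_norm nsKH) x Hx.
  apply: set1_inj; rewrite -morphim_set1 // -im_h ?sub1set //.
  by rewrite quotient_set1 // morphim_set1 // mem_quotient.
by rewrite cfIsomE ?mem_quotient // cfQuoE.
Qed.

Lemma p_elt_morphim (aT rT : finGroupType) pi (D : {group aT})
    (f : {morphism D >-> rT}) x :
  pi.-group ('ker f) -> x \in D -> pi.-elt (f x) = pi.-elt x.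
Proof.
move=> piK Dx; apply/idP/idP=> [pi_fx|]; last exact: morph_p_elt.
rewrite /p_elt (@pnat_dvd _ (#[f x] * #|'ker f|)%N) ?pnatM //; last exact/andP.
rewrite order_dvdn expgM expg_cardG //.
by apply/kerP; rewrite ?groupX // morphX // expg_order.
Qed.

Lemma picfres_Morph (aT rT : finGroupType) pi (D G : {group aT})
    (f : {morphism D >-> rT}) (phi : 'CF(f @* G)) :
    G \subset D -> pi.-group ('ker f) ->
  cfMorph (picfres pi phi) = picfres pi (cfMorph phi).
Proof.
move=> sGD piK; apply/cfun_inP=> x Gx; have Dx := subsetP sGD x Gx.
by rewrite picfresE !cfMorphE // picfresE !inE Gx mem_morphim // p_elt_morphim.
Qed.

(** This transports along Gallagher's bijection, multiplication by the extension ['chi_u] of t. *)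
Lemma pi_basis_extension (gT : finGroupType) pi (G Q : {group gT}) (t : Iirr Q)
    (u : Iirr G) :
    Q <| G -> pi.-group Q -> 'Res[Q] 'chi_u = 'chi_t ->
    'O_pi^'(G) \subset cfker 'chi_u ->
    (exists B, pi_basis pi [set: Iirr (G / Q)] B) ->
  exists B, pi_basis pi [set j in irr_constt ('Ind[G] 'chi_t)] B.
Proof.
move=> nsQG piQ resu keru [B basB]; have [sQG nQG] := andP nsQG.
have [irrM injM imM _] := constt_Ind_ext nsQG resu.
have -> : [set j in irr_constt ('Ind[G] 'chi_t)] =
    mul_mod_Iirr u @: [set: Iirr (G / Q)].
  apply/setP=> j; rewrite in_set imM; apply/codomP/imsetP=> [[i ->]|[i _ ->]].
    by exists i; rewrite ?inE.
  by exists i.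
exists (mul_mod_Iirr u @: B).
have mulE i : 'chi_(mul_mod_Iirr u i) = ('chi_i %% Q)%CF * 'chi_u.
  by rewrite cfIirrE ?irrM // mod_IirrE.
pose L : {additive 'CF(G / Q) -> 'CF(G)} := GRing.mulr_fun 'chi_u (@cfMod gT G Q).
apply: (pi_basis_transfer (L := L) (L' := idfun)) basB _ _ _ _ _ _ => //.
- by move=> i j _ _; apply: injM.
- by move=> j _; rewrite /= mulE.
- move=> phi; rewrite /= /cfMod picfres_Morph ?ker_coset //.
  by rewrite /picfres mulrA.
move=> i Bi keri; rewrite mulE; apply: (subset_trans _ (cfker_mul _ _)).
rewrite subsetI keru andbT sub_cfker_mod ?(subset_trans (pcore_sub _ _)) //.
by apply: subset_trans keri; apply: morphim_pcore.
Qed.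

(** In the preimage W of the core, the kernel is a central Hall pi-subgroup. A Schur-Zassenhaus
    complement is therefore normal in W, so it is O_pi'(W), and it maps onto the core. *)
Lemma pcore_morphim_central (aT rT : finGroupType) pi (D : {group aT})
    (f : {morphism D >-> rT}) :
    pi.-group ('ker f) -> 'ker f \subset 'Z(D) ->
  'O_pi^'(f @* D) \subset f @* 'O_pi^'(D).
Proof.
move=> piK cKD; set O := 'O_pi^'(f @* D).
pose W := (f @*^-1 O)%G; have sWD : W \subset D := subsetIl _ _.
have sKW : 'ker f \subset W by apply: ker_sub_pre.
have nsWD : W <| D.
  have : W <| f @*^-1 (f @* D).
    by rewrite morphpre_normal ?morphim_sub ?pcore_normal ?gFsub.
  by rewrite morphimGK // subsetIl.
have defO : f @* W = O by apply: morphpreK; apply: gFsub.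
have nsKW : 'ker f <| W := normalS sKW sWD (ker_normal f).
have iWK : #|W : 'ker f| = #|O|.
  by rewrite -defO card_morphim (setIidPr sWD).
have hallK : Hall W ('ker f).
  by rewrite /Hall sKW iWK; apply: pnat_coprime piK (pcore_pgroup _ _).
have /splitsP[C /complP[tiKC defW]] := SchurZassenhaus_split hallK nsKW.
have sCW : C \subset W by rewrite -defW mulG_subr.
have nCW : C <| W.
  rewrite /normal sCW -defW mul_subG ?normG // cents_norm //.
  by rewrite centsC (subset_trans (subset_trans sCW sWD)) // centsC (subset_trans cKD) ?subsetIr.
have cardC : #|C| = #|O|.
  by rewrite -iWK -divgS // -defW (TI_cardMg tiKC) mulKn.
have pi'C : pi^'.-group C by rewrite /pgroup cardC; apply: pcore_pgroup.
have hallC : pi^'.-Hall(W) C.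
  rewrite /pHall sCW pi'C -divgS // -defW (TI_cardMg tiKC) mulnK ?cardG_gt0 //.
  by rewrite pnatNK.
have sCO : C \subset 'O_pi^'(D).
  apply: pcore_max => //; rewrite -(normal_Hall_pcore hallC nCW).
  exact: char_normal_trans (pcore_char _ _) nsWD.
rewrite -defO -defW morphimMl ?subsetIl // morphim_ker mul1g.
exact: morphimS.
Qed.

Lemma pi_basis_morphim (aT rT : finGroupType) pi (D : {group aT})
    (f : {morphism D >-> rT}) (A B : {set Iirr D}) :
    pi.-group ('ker f) -> 'ker f \subset 'Z(D) ->
    {in A, forall i, 'ker f \subset cfker 'chi_i} -> pi_basis pi A B ->
  exists B', pi_basis pi [set k : Iirr (f @* D) | morph_Iirr k \in A] B'.
Proof.
move=> piK cKD kerA basB; have sBA := basB.1.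
pose h i := odflt 0 [pick k : Iirr (f @* D) | morph_Iirr k == i].
have hE i : i \in A -> morph_Iirr (h i) = i.
  move=> Ai; rewrite /h; case: pickP => [k /eqP //|noh].
  have kerD : 'ker_D f \subset cfker 'chi_i by rewrite (subset_trans (subsetIr _ _)) ?kerA.
  have [k chik] := irr_factor_morphim (R := (f @* D)%G) (subxx D) (erefl _) kerD.
  case/eqP: (noh k); apply: irr_inj; rewrite morph_IirrE //.
  by apply/cfun_inP=> x Dx; rewrite cfMorphE // chik.
have -> : [set k : Iirr (f @* D) | morph_Iirr k \in A] = h @: A.
  apply/setP=> k; rewrite in_set; apply/idP/imsetP=> [Ak|[i Ai ->]]; last by rewrite hE.
  by exists (morph_Iirr k); rewrite //; apply: (morph_Iirr_inj (subxx D)); rewrite hE.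
exists (h @: B).
apply: (pi_basis_transfer (L := idfun) (L' := @cfMorph _ _ D f D)) basB _ _ _ _ _ _ => //.
- by move=> i j Ai Aj eq_h; rewrite -(hE i Ai) eq_h hE.
- by move=> i Ai; rewrite /= -morph_IirrE // hE.
- exact: cfMorph_inj.
- by move=> phi; rewrite /= picfres_Morph.
move=> i Bi keri; apply: subset_trans (pcore_morphim_central piK cKD) _.
apply/subsetP=> _ /morphimP[x Dx Ox ->].
have Ai := subsetP sBA i Bi.
have chiE y : y \in D -> 'chi_(h i) (f y) = 'chi_i y.
  by move=> Dy; rewrite -cfMorphE // -morph_IirrE // hE.
rewrite cfkerEirr inE -(morph1 f) !chiE ?group1 //.
by have := subsetP keri x Ox; rewrite cfkerEirr inE.
Qed.

(** * Pi-separability *)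

(* Unlike the existence of a series, this form of pi-separability is plainly   *)
(* inherited by subgroups and images.                                          *)
Definition pi_sep_sections (gT : finGroupType) (pi : nat_pred) (G : {group gT}) : Prop :=
  forall H M : {group gT}, H \subset G -> M <| H -> M \proper H ->
  exists V : {group gT}, [/\ V <| H, M \proper V
    & pi.-nat #|V : M| || pi^'.-nat #|V : M| ].

Lemma pi_sep_sections_sub (gT : finGroupType) pi (G H : {group gT}) :
  H \subset G -> pi_sep_sections pi G -> pi_sep_sections pi H.
Proof. by move=> sHG sepG L M sLH; apply/sepG/(subset_trans sLH). Qed.

Lemma normal_joing_index (gT : finGroupType) (H M X : {group gT}) :
    M <| H -> X <| H -> ~~ (X \subset M) ->
  [/\ (M <*> X)%G <| H, M \proper (M <*> X)%G & #|M <*> X : M| = #|X : M|].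
Proof.
move=> nsMH nsXH nsXM; have [sMH nMH] := andP nsMH; have [sXH nXH] := andP nsXH.
split; first exact: normalY.
  by rewrite properE joing_subl join_subG negb_and nsXM orbT.
have nMX : X \subset 'N(M) := subset_trans sXH nMH.
rewrite -!card_quotient // ?join_subG ?normG //.
by rewrite norm_joinEr // quotientMidl.
Qed.

(** Take the first term V of the series with H :&: V not inside M, and its predecessor U. Since H
    :&: U lies in M, the index of M in M (H :&: V) divides the order of V / U. *)
Lemma pi_separable_sections (gT : finGroupType) pi (G : {group gT}) :
  pi_separable pi G -> pi_sep_sections pi G.
Proof.
case=> s ser_s last_s H M sHG nsMH ltMH; have [sMH nMH] := andP nsMH.
have : ~~ (H :&: last 1%G s \subset M).
  by rewrite last_s (setIidPl sHG); move: ltMH; rewrite properE => /andP[].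
have : H :&: 1%G \subset M by rewrite (subset_trans (subsetIr _ _)) ?sub1G.
elim: s 1%G ser_s {last_s} => [|V s IHs] U /=; first by move=> _ ->.
case/andP=> /andP[/and3P[nUG nVG nsUV] piVU] ser_s sUM.
have [sVM | nsVM _] := boolP (H :&: V \subset M); first exact: IHs.
have nsXH : H :&: V <| H by rewrite /normal subsetIl normsI ?normG ?(subset_trans sHG).
have [nsWH ltMW iW] := normal_joing_index nsMH nsXH nsVM.
exists (M <*> (H :&: V))%G; split=> //; rewrite iW.
have nUX : H :&: V \subset 'N(U).
  by rewrite (subset_trans (subsetIr _ _)) // normal_norm.
have dvX : (#|H :&: V : M| %| #|V / U|%g)%N.
  apply: (@dvdn_trans #|(H :&: V) / U|%g); last by rewrite cardSg ?quotientS ?subsetIr.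
  rewrite card_quotient // -indexgI -(indexgI _ U).
  rewrite -(@Lagrange_index _ (H :&: V) (H :&: V :&: M) (H :&: V :&: U)) ?subsetIl //.
    exact: dvdn_mulr.
  rewrite subsetI subsetIl /= (subset_trans _ sUM) //.
  by rewrite setSI // subsetIl.
by case/orP: piVU => piVU; rewrite (pnat_dvd dvX piVU) ?orbT.
Qed.

Lemma pi_sep_sections_morphim (aT rT : finGroupType) pi (D G : {group aT})
    (f : {morphism D >-> rT}) :
  G \subset D -> pi_sep_sections pi G -> pi_sep_sections pi (f @* G).
Proof.
move=> sGD sepG H' M' sH'G nsMH' ltMH'; have [sMH' nMH'] := andP nsMH'.
pose H := (G :&: f @*^-1 H')%G; pose M := (G :&: f @*^-1 M')%G.
have fH : f @* H = H' by rewrite morphim_setIpre (setIidPr sH'G).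
have fM : f @* M = M' by rewrite morphim_setIpre (setIidPr (subset_trans sMH' sH'G)).
have sMH : M \subset H by rewrite setIS // morphpreS.
have nsMH : M <| H.
  rewrite /normal sMH normsI //=.
    by apply: subset_trans (normG G); apply: subsetIl.
  apply: (subset_trans (subsetIr _ _)).
  exact: subset_trans (morphpreS _ nMH') (morphpre_norm _ _).
have ltMH : M \proper H.
  rewrite properE sMH; apply: contraL ltMH' => sHM.
  by rewrite properE negb_and negbK -fH -fM (morphimS f sHM) orbT.
have [V [nsVH ltMV piV]] := sepG H M (subsetIl _ _) nsMH ltMH.
have sVG : V \subset G := subset_trans (normal_sub nsVH) (subsetIl _ _).
exists (f @* V)%G; split; first by rewrite -fH morphim_normal.
  apply/andP; split; first by rewrite -fM morphimS // proper_sub.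
  apply: contraL ltMV => sVM'.
  rewrite properE negb_and negbK; apply/orP; right.
  by rewrite subsetI sVG -sub_morphim_pre ?(subset_trans sVG sGD) // -fM.
have dv : (#|f @* V : f @* M| %| #|V : M|)%N.
  by rewrite index_morphim // subIset // (subset_trans sVG).
by rewrite -fM; case/orP: piV => piV; rewrite (pnat_dvd dv piV) ?orbT.
Qed.

(** Either the kernel contributes a pi-section of H above M, or M contains its part in H and the
    section is visible in the image. *)
Lemma pi_sep_sections_extension (aT rT : finGroupType) pi (D : {group aT})
    (f : {morphism D >-> rT}) :
  pi.-group ('ker f) -> pi_sep_sections pi (f @* D) -> pi_sep_sections pi D.
Proof.
move=> piK sepfD H M sHD nsMH ltMH; have [sMH nMH] := andP nsMH.
pose X := 'ker_H f; have nsXH : X <| H.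
  by rewrite /normal subsetIl normsI ?normG // (subset_trans sHD) ?ker_norm.
have [sXM | nsXM] := boolP ((X : {set aT}) \subset M); last first.
  have [nsWH ltMW iW] := normal_joing_index nsMH nsXH nsXM.
  exists (M <*> X)%G; split=> //; rewrite iW -indexgI.
  apply/orP; left; apply: pnat_dvd (dvdn_indexg _ _) _.
  exact: pgroupS (subsetIr _ _) piK.
have nsfM : f @* M <| f @* H by rewrite morphim_normal.
have eqM (A : {group aT}) : A \subset H -> f @* A \subset f @* M -> A \subset M.
  move=> sAH; have sAD := subset_trans sAH sHD.
  rewrite sub_morphim_pre // morphimK ?(subset_trans sMH sHD) // => sAKM.
  apply/subsetP=> x Ax.
  have /mulsgP[k m Kk Mm defx] := subsetP sAKM x Ax.
  rewrite defx groupM // (subsetP sXM) // inE Kk andbT.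
  by rewrite -(groupMr _ (subsetP sMH m Mm)) -defx (subsetP sAH).
have ltfM : f @* M \proper f @* H.
  apply/andP; split; first exact: morphimS.
  apply: contraL ltMH => /(eqM _ (subxx H)) sHM.
  by rewrite properE sHM andbF.
have [V [nsVH ltMV piV]] := sepfD _ _ (morphimS f sHD) nsfM ltfM.
pose W := (H :&: f @*^-1 V)%G.
have fW : f @* W = V by rewrite morphim_setIpre (setIidPr (normal_sub nsVH)).
have sMW : M \subset W.
  by rewrite subsetI sMH -sub_morphim_pre ?(subset_trans sMH sHD) ?(proper_sub ltMV).
exists W; split.
- rewrite /normal subsetIl normsI ?normG //.
  apply: subset_trans (morphpre_norm _ _).
  by rewrite -sub_morphim_pre // normal_norm.
- rewrite properE sMW; apply: contraL ltMV => sWM.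
  by rewrite properE negb_and negbK -fW (morphimS f sWM) orbT.
have -> : #|W : M| = #|V : f @* M|.
  rewrite -[in RHS]fW -(index_morphim_ker f sMW) ?(subset_trans (subsetIl _ _)) //.
  rewrite -[X in (_ * X)%N]indexgI (setIidPl _) ?indexgg ?muln1 //.
  by apply: subset_trans sXM; rewrite setSI // subsetIl.
by [].
Qed.

(** * Existence of a basis *)

Lemma constt_Ind0 (gT : finGroupType) (G H : {group gT}) j :
  H <| G -> (j \in irr_constt ('Ind[G, H] 'chi_0)) = (H \subset cfker 'chi_j).
Proof.
move=> nsHG; rewrite constt_Ind_Res; apply/idP/idP; first exact: constt0_Res_cfker.
move=> kerH; rewrite irr_consttE cfRes_sub_ker // cfdotZl irr0 cfnorm1 mulr1.
exact: irr1_neq0.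
Qed.

Lemma pi_basis_central_extension (hT gT : finGroupType) pi (D : {group hT})
    (f : {morphism D >-> gT}) (Q : {group hT}) (t : Iirr (f @* Q)) (u : Iirr D) :
    pi.-group ('ker f) -> 'ker f \subset 'Z(D) -> Q <| D -> pi.-group Q ->
    'Res[Q] 'chi_u \in irr Q -> {in Q, forall y, 'chi_u y = 'chi_t (f y)} ->
    'O_pi^'(D) \subset cfker 'chi_u ->
    (exists B, pi_basis pi [set: Iirr (D / Q)] B) ->
  exists B, pi_basis pi [set j in irr_constt ('Ind[f @* D] 'chi_t)] B.
Proof.
move=> piK cKD nsQD piQ /irrP[s ress] chiu keru XDQ.
have [sQD nQD] := andP nsQD.
have [B basB] := pi_basis_extension nsQD piQ ress keru XDQ.
have nsKD : 'ker f <| D := ker_normal f.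
(* Index 0 is the trivial character of the kernel: this keeps the characters that factor through
   f. *)
have := pi_basis_restrict 0 nsKD piK basB; rewrite /=.
set A := _ :&: _ => basA.
have kerA : {in A, forall i, 'ker f \subset cfker 'chi_i}.
  by move=> i /setIP[_]; rewrite in_set constt_Ind0.
have [B' basB'] := pi_basis_morphim piK cKD kerA basA.
exists B'; congr (pi_basis pi _ B'): basB'.
apply/setP=> k; rewrite !in_set constt_Ind0 // morph_IirrE //.
have -> : 'ker f \subset cfker (cfMorph 'chi_k).
  apply/subsetP=> x Kx; have Dx := dom_ker Kx.
  rewrite -morph_IirrE // cfkerEirr inE morph_IirrE // !cfMorphE ?group1 //.
  by rewrite (mker Kx) morph1.
rewrite andbT !constt_Ind_Res !irr_consttE morph_IirrE // cfResMorph //.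
have -> : 'chi_s = cfMorph 'chi_t.
  by apply/cfun_inP=> y Qy; rewrite -ress cfResE // chiu // cfMorphE.
by rewrite cfMorph_iso.
Qed.

Lemma pi_basis_invariant (gT : finGroupType) pi (G P : {group gT}) (t : Iirr P) :
    P <| G -> pi.-group P -> G \subset 'I['chi_t] -> pi_sep_sections pi G ->
    (forall (rT : finGroupType) (L Z : {group rT}),
       pi_sep_sections pi L -> Z \subset 'Z(L) -> pi.-group Z ->
       #|L : Z| = #|G : P| -> exists B, pi_basis pi [set: Iirr L] B) ->
  exists B, pi_basis pi [set j in irr_constt ('Ind[G] 'chi_t)] B.
Proof.
move=> nsPG piP IGt sepG IH.
have [hT [f [Q [u [[imf cK cardK] [nsQ tiKQ imQ] [resu chiu] cQu]]]]] :=
  invariant_irr_central_extension nsPG IGt.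
have defG : G = (f @* [set: hT])%G by apply/val_inj.
have defP : P = (f @* Q)%G by apply/val_inj.
have piK : pi.-group ('ker f).
  by rewrite /pgroup cardK pnatX [pi.-nat _]piP.
have cardQ : #|Q| = #|P|.
  by rewrite -imQ card_morphim setTI -indexgI setIC tiKQ indexg1.
have imQ' : #|f @* Q| = #|Q| by rewrite imQ cardQ.
have piQ : pi.-group Q by rewrite /pgroup cardQ.
subst G P; apply: pi_basis_central_extension chiu _ _ => //.
  apply/subsetP=> y Oy; rewrite cfkerEirr inE cQu //.
    apply: (subsetP (coprime_normal_cents (pcore_normal _ _) nsQ _)) Oy.
    by rewrite coprime_sym; apply: pnat_coprime piQ (pcore_pgroup _ _).
  rewrite coprime_sym; apply: pnat_coprime piP _.
  exact: mem_p_elt (pcore_pgroup _ _) Oy.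
have nQT : [set: hT] \subset 'N(Q) := normal_norm nsQ.
(* The kernel meets Q trivially and |Q| = |P|, so in the quotient by Q the image of the kernel has
   index |G : P|. *)
apply: (IH _ _ ('ker f / Q)%G).
- apply: pi_sep_sections_morphim => //.
  exact: pi_sep_sections_extension piK sepG.
- by apply: (subset_trans (quotientS _ cK)); apply: morphim_center.
- exact: quotient_pgroup.
rewrite -!divgS ?quotientS ?morphimS ?subsetT //.
rewrite card_quotient // card_quotient ?(subset_trans _ nQT) ?subsetT //.
rewrite -(indexgI ('ker f)) tiKQ indexg1 card_morphim setTI imQ'.
by rewrite -!divgS ?subsetT // -!divnMA mulnC.
Qed.

(** * Supplements of O_pi'(G) *)

(** The coset K x contains a pi-element y of H. Both cyclic groups complement K in K <[x]>, so they
    are conjugate under K; the conjugate of y agrees with x modulo K, and K meets <[x]>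
    trivially. *)
Lemma pi_elt_supplement (gT : finGroupType) pi (G H K : {group gT}) x :
    K <| G -> pi^'.-group K -> (K * H)%g = G -> x \in pi_elts pi G ->
  exists2 k, k \in K & (x ^ k)%g \in pi_elts pi H.
Proof.
move=> nsKG pi'K defG; rewrite inE => /andP[Gx pi_x].
have [sKG nKG] := andP nsKG; have nKx := subsetP nKG x Gx.
have sHG : H \subset G by rewrite -defG mulG_subr.
have [k1 [y1 [Kk1 Hy1 defx]]] : exists k1 y1, [/\ k1 \in K, y1 \in H & x = (k1 * y1)%g].
  by move: Gx; rewrite -defG => /mulsgP[k1 y1 ? ? ->]; exists k1, y1.
have nKy1 : y1 \in 'N(K) by rewrite (subsetP nKG) ?(subsetP sHG).
pose y := (y1.`_pi)%g; have Hy : y \in H by rewrite groupX.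
have nKy : y \in 'N(K) by rewrite groupX.
have xy1 : coset K y1 = coset K x.
  by rewrite defx morphM ?(subsetP (normG K) k1) //= (coset_id Kk1) mul1g.
have xy : coset K y = coset K x.
  by rewrite /y morph_constt //= xy1 constt_p_elt // morph_p_elt.
have tiK z : pi.-elt z -> K :&: <[z]> = 1%g.
  by move=> pi_z; rewrite coprime_TIg // coprime_sym (pnat_coprime pi_z).
have pi_y : pi.-elt y := p_elt_constt _ _.
have card_coset z : z \in 'N(K) -> pi.-elt z -> #|<[z]>%g| = #[coset K z].
  move=> nKz pi_z; rewrite (card_isog (quotient_isog _ (tiK z pi_z))) ?cycle_subG //.
  by rewrite /= quotient_cycle.
have card_x : #|<[x]>%g| = #|<[y]>%g| by rewrite !card_coset // xy.
have [|||||k Kk defx'] := SchurZassenhaus_trans_actsol (G := K) (A := <[y]>) (B := <[x]>).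
- exact/abelian_sol/cycle_abelian.
- by rewrite cycle_subG.
- rewrite joingC norm_joinEr ?cycle_subG // -quotientSK ?cycle_subG //.
  by rewrite !quotient_cycle // xy.
- by rewrite coprime_sym (pnat_coprime pi_y).
- by rewrite card_x.
exists k^-1%g; first by rewrite groupV.
rewrite inE p_eltJ pi_x andbT.
suffices -> : x = (y ^ k)%g by rewrite conjgK.
have yk_x : (y ^ k)%g \in <[x]>%g by rewrite defx' memJ_conjg cycle_id.
have nKk : k \in 'N(K) := subsetP (normG K) k Kk.
have nKyk : (y ^ k)%g \in 'N(K) by rewrite groupJ.
apply/eqP; rewrite eq_sym eq_mulgV1 -in_set1 -/(1%g) -[[set _]](tiK x pi_x).
apply/setIP; split; last by rewrite groupM ?groupV ?cycle_id.
apply: coset_idr; first by rewrite groupM ?groupV.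
by rewrite morphM ?groupV // morphJ // morphV //= (coset_id Kk) conjg1 xy mulgV.
Qed.

(** A lift for H is trivial on H :&: K, hence extends to G through G / K. The new matrix is the
    restriction matrix times that of H: its columns are induced from H, and its row identities can
    be checked on H because every pi-element of G is conjugate into H. *)
Lemma pi_basis_supplement (gT : finGroupType) pi (G H : {group gT}) :
    ('O_pi^'(G) * H)%g = G -> (exists B, pi_basis pi [set: Iirr H] B) ->
  exists B, pi_basis pi [set: Iirr G] B.
Proof.
set K := 'O_pi^'(G)%G => defG [B1 [_ [d1 [d1A d1B d1R d1K]]]].
have nsKG : K <| G := pcore_normal _ _; have [sKG nKG] := andP nsKG.
have pi'K : pi^'.-group K := pcore_pgroup _ _.
have sHG : H \subset G by rewrite -defG mulG_subr.
have nKH := subset_trans sHG nKG.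
pose h i := odflt 0 [pick j : Iirr G | (K \subset cfker 'chi_j) && ('Res[H] 'chi_j == 'chi_i)].
have hP i : i \in B1 -> (K \subset cfker 'chi_(h i)) /\ 'Res[H] 'chi_(h i) = 'chi_i.
  move=> Bi; rewrite /h; case: pickP => [j /andP[kerj /eqP resj] // | noj].
  have kerH : 'ker_H (coset K) \subset cfker 'chi_i.
    rewrite ker_coset; apply: subset_trans (d1K i Bi); apply: pcore_max.
      exact: pgroupS (subsetIr _ _) pi'K.
    by rewrite /normal subsetIl normsI ?normG.
  have defR : coset K @* H = (G / K)%G.
    by rewrite -[LHS]/(H / K)%g -quotientMidl defG.
  have [k chik] := irr_factor_morphim nKH defR kerH.
  case/andP: (noj (mod_Iirr k)); rewrite mod_IirrE // cfker_mod //; split=> //.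
  by apply/eqP/cfun_inP=> x Hx; rewrite cfResE // cfModE ?(subsetP sHG) // -chik.
pose g j := cfIirr ('Res[H] 'chi[G]_j).
have hK : {in B1, cancel h g} by move=> i /hP[_ resi]; rewrite /g resi irrK.
pose c j l := Num.truncn '['Res[H] 'chi[G]_j, 'chi_l].
have cE j l : (c j l)%:R = '['Res[H] 'chi[G]_j, 'chi_l].
  by rewrite truncnK // Cnat_cfdot_char_irr ?cfRes_char ?irr_char.
have ResE j : 'Res[H] 'chi[G]_j = \sum_l 'chi_l *+ c j l.
  rewrite [LHS]cfun_sum_cfdot; apply: eq_bigr => l _.
  by rewrite -cE scaler_nat.
have IndE l : 'Ind[G] 'chi[H]_l = \sum_j 'chi_j *+ c j l.
  rewrite [LHS]cfun_sum_cfdot; apply: eq_bigr => j _.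
  by rewrite -cfdot_Res_r cfdotC -cE conj_natr ?natr_nat // scaler_nat.
pose d j i := (\sum_l c j l * d1 l (g i))%N.
have d_sum j i : i \in B1 -> d j (h i) = (\sum_l c j l * d1 l i)%N.
  by move=> Bi; rewrite /d hK.
exists (h @: B1); split; first exact: subsetT.
exists d; split.
- move=> _ /imsetP[i Bi ->].
  have -> : \sum_(j in [set: Iirr G]) 'chi_j *+ d j (h i) =
      'Ind[G] (\sum_(l in [set: Iirr H]) 'chi_l *+ d1 l i).
    rewrite linear_sum /= (eq_bigl predT) => [|j]; last by rewrite inE.
    rewrite [RHS](eq_bigl predT) => [|l]; last by rewrite inE.
    under [RHS]eq_bigr do rewrite raddfMn /= IndE -sumrMnl.
    rewrite exchange_big; apply: eq_bigr => j _ /=.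
    by rewrite d_sum // -sumrMnr; apply: eq_bigr => l _; rewrite mulrnA.
  rewrite picfres_on -picfres_Ind //; apply/eqP; congr ('Ind _).
  by apply/eqP; rewrite -picfres_on d1A.
- move=> _ _ /imsetP[j Bj ->] /imsetP[i Bi ->].
  have cij l : c (h i) l = (l == i).
    by apply/eqP; rewrite -eqC_nat cE (hP i Bi).2 cfdot_irr (eq_sym l).
  rewrite d_sum // (bigD1 i) //= big1 => [|l /negPf ne_li].
    by rewrite cij eqxx mul1n addn0 d1B // (inj_in_eq (can_in_inj hK)).
  by rewrite cij ne_li.
- move=> j _; set F := \sum_(i in _) _.
  have F_on : picfres pi F = F.
    rewrite /F picfres_sum; apply: eq_bigr => i _; congr (_ *+ _).
    by apply/cfunP=> x; rewrite !picfresE; case: (x \in _).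
  have ResF : 'Res[H] (picfres pi 'chi_j) = 'Res[H] F.
    rewrite Res_picfres // ResE.
    rewrite (eq_bigl [in [set: Iirr H]]) => [|l]; last by rewrite inE.
    rewrite picfres_sum /F big_imset /=; last exact: can_in_inj hK.
    rewrite linear_sum /=.
    under eq_bigr => l _ do rewrite d1R ?inE // -sumrMnl.
    rewrite exchange_big; apply: eq_bigr => i Bi /=.
    rewrite raddfMn /= Res_picfres // (hP i Bi).2 d_sum // -sumrMnr.
    apply: eq_big => [l | l _]; first by rewrite inE.
    by rewrite -mulrnA mulnC.
  apply/cfunP=> x; have [Gx | nGx] := boolP (x \in pi_elts pi G).
    have [k Kk Hxk] := pi_elt_supplement nsKG pi'K defG Gx.
    have Gk := subsetP sKG k Kk; have := congr1 (fun phi : 'CF(H) => phi (x ^ k)%g) ResF.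
    by rewrite !cfResE ?cfunJ //; move: Hxk; rewrite inE => /andP[].
  by rewrite -F_on !picfresE (negPf nGx).
by move=> _ /imsetP[i /hP[kerh _] ->].
Qed.

Lemma pi_basis_pgroup (gT : finGroupType) pi (G : {group gT}) :
  pi.-group G -> pi_basis pi [set: Iirr G] [set: Iirr G].
Proof.
move=> piG; split; first exact: subxx.
have sumE (F : Iirr G -> 'CF(G)) (b : Iirr G -> bool) i :
    (forall j, b j = (j == i)) -> \sum_(j in [set: Iirr G]) F j *+ b j = F i.
  move=> bE; rewrite (bigD1 i) ?inE //= bE eqxx big1 ?addr0 // => j /andP[_ /negPf ne].
  by rewrite bE ne.
exists (fun j i => j == i); split=> [i _ | // | j _ | i _].
- by rewrite (sumE _ _ i) // picfres_on picfres_pgroup.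
- by rewrite (sumE _ _ j) // => i; apply: eq_sym.
suffices -> : 'O_pi^'(G) = 1%g by apply: sub1G.
apply/eqP; rewrite trivg_card1; apply/eqP/(@pnat_1 pi _ _ (pcore_pgroup _ _)).
exact: pgroupS (pcore_sub _ _) piG.
Qed.

(** * Frattini arguments and the induction *)

Lemma normal_Sylows_solvable (gT : finGroupType) (K : {group gT}) :
    (forall (p : nat) (R : {group gT}), p.-Sylow(K) R -> R <| K) ->
  solvable K.
Proof.
move=> nsSyl; apply: solvableS (nilpotent_sol (Fitting_nil K)).
rewrite -{1}(Sylow_gen K) gen_subG; apply/bigcupsP=> R /SylowP[p p_pr sylR].
by apply: Fitting_max; [apply: nsSyl sylR | apply: pgroup_nil (pHall_pgroup sylR)].
Qed.

(** Each G-conjugate of Q is again a complement of K in V, hence a K-conjugate by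
    Schur-Zassenhaus. *)
Lemma Frattini_complement (gT : finGroupType) (G V K Q : {group gT}) :
    K <| G -> V <| G -> solvable K -> (K * Q)%g = V -> coprime #|K| #|Q| ->
  (K * 'N_G(Q))%g = G.
Proof.
move=> nsKG nsVG solK defV coKQ; have [sKG nKG] := andP nsKG.
have sQV : Q \subset V by rewrite -defV mulG_subr.
have sQG : Q \subset G := subset_trans sQV (normal_sub nsVG).
apply/eqP; rewrite eqEsubset mul_subG ?subsetIl //=; apply/subsetP=> y Gy.
have [||||x Kx defQ] := SchurZassenhaus_trans_sol (H := K) (K := Q) (K1 := (Q :^ y)%G) solK.
- exact: subset_trans nKG.
- rewrite defV -(normP (subsetP (normal_norm nsVG) y Gy)).
  by rewrite conjSg.
- by [].
- by rewrite cardJg.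
have Gx := subsetP sKG x Kx.
have -> : y = (y * x^-1 * x)%g by rewrite mulgKV.
rewrite -normC ?(subset_trans (subsetIl _ _)) // mem_mulg //.
rewrite inE groupM ?groupV //=; apply/normP.
by rewrite conjsgM defQ conjsgK.
Qed.

Lemma central_pcore_quotient (gT : finGroupType) pi (P V : {group gT}) :
    pi.-group P -> P \subset 'Z(V) -> pi^'.-nat #|V : P| ->
  V \subset (P * 'O_pi^'(V))%g.
Proof.
move=> piP cPV pi'VP; have sPV := subset_trans cPV (center_sub V).
have nPV : V \subset 'N(P).
  by rewrite cents_norm // centsC (subset_trans cPV) ?subsetIr.
pose f := restrm_morphism nPV (coset_morphism P).
have kerf : 'ker f = P by rewrite ker_restrm ker_coset; apply/setIidPr.
have := @pcore_morphim_central _ _ pi V f; rewrite kerf => /(_ piP cPV).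
rewrite !morphim_restrm setIid (setIidPr (pcore_sub _ _)).
rewrite -[coset P @* V]/(V / P)%g -[coset P @* 'O_pi^'(V)]/('O_pi^'(V) / P)%g.
have pi'Vq : pi^'.-group (V / P)%g by rewrite /pgroup card_quotient.
rewrite (pcore_pgroup_id pi'Vq).
by rewrite quotientSK // normC // (subset_trans (pcore_sub _ _)).
Qed.

Theorem pi_basis_exists (gT : finGroupType) pi (G : {group gT}) :
  pi_sep_sections pi G -> exists B, pi_basis pi [set: Iirr G] B.
Proof.
(* The order of G is no measure, since central extensions may enlarge the group; |G : Z| is,
   starting from Z = 1. *)
have [Z cZ piZ] : exists2 Z : {group gT}, Z \subset 'Z(G) & pi.-group Z.
  by exists 1%G; rewrite ?sub1G ?pgroup1.
have [n] := ubnP #|G : Z|; elim: n => // n IHn in gT G Z cZ piZ *.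
move=> /ltnSE leGn sepG.
have sZG : Z \subset G := subset_trans cZ (center_sub G).
have cGZ : G \subset 'C(Z) by rewrite centsC (subset_trans cZ) ?subsetIr.
have nsZG : Z <| G by rewrite /normal sZG cents_norm.
have IHsub (H : {group gT}) : Z \subset H -> H \proper G ->
    exists B, pi_basis pi [set: Iirr H] B.
  move=> sZH ltHG; have sHG := proper_sub ltHG.
  apply: (IHn _ H Z) => //; last exact: pi_sep_sections_sub sepG.
    by rewrite subsetI sZH (subset_trans cZ) // (subset_trans (subsetIr _ _)) ?centS.
  apply: leq_trans _ leGn; rewrite -(Lagrange_index sHG sZH).
  by rewrite ltn_Pmull ?indexg_gt0 // indexg_gt1 proper_subn.
pose P := 'O_pi(G)%G; pose K := 'O_pi^'(G)%G.
have nsPG : P <| G := pcore_normal _ _; have piP : pi.-group P := pcore_pgroup _ _.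
have nsKG : K <| G := pcore_normal _ _; have pi'K : pi^'.-group K := pcore_pgroup _ _.
have [cPG | ncPG] := boolP (P \subset 'Z(G)); last first.
  apply: (pi_basis_glue nsPG) => t.
  have sZP : Z \subset P by apply: pcore_max.
  have [IGt | nIGt] := boolP (G \subset 'I['chi_t]).
    apply: pi_basis_invariant => // rT L Y sepL cYL piY iLY.
    (* P contains Z strictly, as Z is central and P is not. *)
    apply: (IHn _ L Y) => //; rewrite iLY; apply: leq_trans _ leGn.
    rewrite -(Lagrange_index (normal_sub nsPG) sZP).
    rewrite ltn_Pmulr ?indexg_gt0 // indexg_gt1.
    by apply: contra ncPG => sPZ; apply: subset_trans cZ.
  apply: pi_basis_inertia => //; apply: IHsub.
    by apply: subset_trans cZ _; apply: center_sub_Inertia (normal_sub nsPG).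
  rewrite properE subsetIl subsetI subxx /=; exact: nIGt.
have [/existsP[H /and3P[sZH ltHG /eqP defG]] | nosupp] :=
    boolP [exists H : {group gT}, [&& Z \subset H, H \proper G & (K * H)%g == G]].
  by apply: pi_basis_supplement defG _; apply: IHsub.
(* The normaliser contains the central Z, so it cannot be a proper supplement of K. *)
have noN (Q : {group gT}) : Q \subset G -> (K * 'N_G(Q))%g = G -> Q <| G.
  move=> sQG defG; rewrite /normal sQG.
  have : ~~ ('N_G(Q) \proper G).
    apply: contra nosupp => ltNG; apply/existsP; exists 'N_G(Q)%G.
    rewrite ltNG defG eqxx subsetI sZG andbT /= cents_norm //.
    by rewrite (subset_trans _ (centS sQG)) // centsC.
  by rewrite properE subsetIl /= negbK subsetI subxx.
have solK : solvable K.
  apply: normal_Sylows_solvable => p R sylR; have sRK := pHall_sub sylR.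
  have sRG := subset_trans sRK (normal_sub nsKG).
  apply: (normalS sRK (normal_sub nsKG)); apply: noN => //.
  exact: Frattini_arg sylR.
have [defG | ltPKG] := eqVneq (K * P)%g G.
  apply: pi_basis_supplement defG _; exists [set: Iirr P].
  exact: pi_basis_pgroup.
pose PK := (K <*> P)%G; have defPK : (K * P)%g = PK.
  by rewrite /= norm_joinEr // (subset_trans (normal_sub nsPG)) ?normal_norm.
have nsPKG : PK <| G by apply: normalY.
have ltPK : PK \proper G.
  rewrite properEneq normal_sub // andbT; apply: contra ltPKG => /eqP defG.
  by rewrite defPK defG.
have [V [nsVG ltPKV piV]] := sepG G PK (subxx G) nsPKG ltPK.
have [sVG nVG] := andP nsVG; have sPKV := proper_sub ltPKV.
have sKV : K \subset V := subset_trans (joing_subl K P) sPKV.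
have sPV : P \subset V := subset_trans (joing_subr K P) sPKV.
suffices sVPK : V \subset PK by move: ltPKV; rewrite properE sVPK andbF.
have cPV : P \subset 'Z(V).
  by rewrite subsetI sPV (subset_trans cPG) // (subset_trans (subsetIr _ _)) ?centS.
case/orP: piV => piV.
  (* A complement Q of K in V is normal in G by Frattini, so it lies in P. *)
  have piVK : pi.-nat #|V : K|.
    rewrite -(Lagrange_index sPKV (joing_subl K P)) pnatM piV /=.
    rewrite -card_quotient ?join_subG ?normG ?(subset_trans (normal_sub nsPG)) ?normal_norm //.
    by rewrite -defPK quotientMidl; apply: quotient_pgroup.
  have hallK : Hall V K.
    by rewrite /Hall sKV coprime_sym; apply: pnat_coprime piVK pi'K.
  have nsKV : K <| V := normalS sKV sVG nsKG.
  have /splitsP[Q /complP[tiKQ defV]] := SchurZassenhaus_split hallK nsKV.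
  have sQV : Q \subset V by rewrite -defV mulG_subr.
  have piQ : pi.-group Q.
    by move: piVK; rewrite -divgS // -defV (TI_cardMg tiKQ) mulKn.
  have coKQ : coprime #|K| #|Q| by rewrite coprime_sym; apply: pnat_coprime piQ pi'K.
  have nsQG := noN Q (subset_trans sQV sVG) (Frattini_complement nsKG nsVG solK defV coKQ).
  by rewrite -defV -defPK mulgS // pcore_max.
(* P is central in V with pi'-index, so V = P O_pi'(V), and O_pi'(V) lies in K. *)
rewrite -defPK; have piVP : pi^'.-nat #|V : P|.
  rewrite -(Lagrange_index sPKV (joing_subr K P)) pnatM piV /=.
  rewrite -card_quotient ?join_subG ?normG ?(subset_trans (normal_sub nsKG)) ?normal_norm //.
  by rewrite -defPK quotientMidr; apply: quotient_pgroup.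
apply: subset_trans (central_pcore_quotient piP cPV piVP) _.
rewrite -normC ?mulSg //.
  apply: pcore_max; first exact: pcore_pgroup.
  exact: char_normal_trans (pcore_char _ _) nsVG.
by rewrite cents_norm // (subset_trans (pcore_sub _ _)) // centsC (subset_trans cPV) ?subsetIr.
Qed.

(** * Products with characters of a quotient *)

(** Pair with column k of the matrix: it vanishes off the pi-elements, so it does not see the
    truncation, and it is dual to the lifts. *)
Lemma pi_basis_indep (gT : finGroupType) pi (G : {group gT}) (B : {set Iirr G})
    (c : Iirr G -> algC) :
    pi_basis pi [set: Iirr G] B ->
    \sum_(i in B) c i *: picfres pi 'chi_i = 0 ->
  {in B, forall i, c i = 0}.
Proof.
case=> _ [d [dA dB _ _]] sum0 k Bk.
pose Phi := \sum_(j in [set: Iirr G]) 'chi_j *+ d j k.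
have Phi_on : Phi \in 'CF(G, pi_elts pi G) by apply: dA.
have dot_pi phi : '[picfres pi phi, Phi] = '[phi, Phi].
  rewrite !(cfdotEr _ Phi_on); congr (_ * _); apply: eq_bigr => x Gx.
  by rewrite picfresE Gx.
have := congr1 (cfdotr Phi) sum0; rewrite /= cfdot0l cfdot_suml (bigD1 k) //=.
have dotE i : i \in B -> '[picfres pi 'chi_i, Phi] = (i == k)%:R.
  move=> Bi; rewrite dot_pi cfdot_sumr (bigD1 i) ?inE //= cfdotMnr cfdot_irr eqxx.
  rewrite big1 ?addr0 => [|j /andP[_ /negPf ne_ji]]; first by rewrite dB.
  by rewrite cfdotMnr cfdot_irr eq_sym ne_ji mul0rn.
rewrite cfdotZl dotE // eqxx mulr1 big1 ?addr0 // => i /andP[Bi /negPf ne_ik].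
by rewrite cfdotZl dotE // ne_ik mulr0.
Qed.

Lemma pi_basis_char (gT : finGroupType) pi (G : {group gT}) (B : {set Iirr G})
    (chi : 'CF(G)) :
    pi_basis pi [set: Iirr G] B -> chi \is a character ->
  exists a : Iirr G -> nat,
    picfres pi chi = \sum_(i in B) picfres pi 'chi_i *+ a i.
Proof.
case=> _ [d [_ _ dR _]] Nchi.
pose c j := Num.truncn '[chi, 'chi_j].
have defchi : chi = \sum_(j in [set: Iirr G]) 'chi_j *+ c j.
  rewrite {1}[chi]cfun_sum_cfdot; apply: eq_big => [j | j _]; first by rewrite inE.
  by rewrite -[in LHS](truncnK (Cnat_cfdot_char_irr j Nchi)) scaler_nat.
exists (fun i => \sum_(j in [set: Iirr G]) d j i * c j)%N.
rewrite {1}defchi picfres_sum.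
under eq_bigr => j Aj do rewrite dR // -sumrMnl.
rewrite exchange_big; apply: eq_bigr => i _ /=; rewrite -sumrMnr.
by apply: eq_bigr => j _; rewrite mulrnA.
Qed.

Lemma picfres1 (gT : finGroupType) pi (G : {group gT}) (phi : 'CF(G)) :
  picfres pi phi 1%g = phi 1%g.
Proof. by rewrite picfresE inE group1 p_elt1. Qed.

Lemma pi_partial_char1_neq0 (gT : finGroupType) pi (G : {group gT}) (phi : 'CF(G)) :
  pi_partial_char pi phi -> phi 1%g != 0.
Proof. by case=> chi [Nchi nz_chi ->]; rewrite picfres1 char1_eq0. Qed.

(** Split off one constituent of phi; irreducibility forces the remainder [psi] to vanish. *)
Lemma pi_basis_Ipi (gT : finGroupType) pi (G : {group gT}) (B : {set Iirr G})
    (phi : 'CF(G)) :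
    pi_basis pi [set: Iirr G] B -> Ipi pi phi ->
  exists2 i, i \in B & phi = picfres pi 'chi_i.
Proof.
move=> basB [phi_char phi_irr]; have nz_phi := pi_partial_char1_neq0 phi_char.
have [chi [Nchi _ defphi]] := phi_char.
have [a def_a] := pi_basis_char basB Nchi.
have [i Bi a_i] : exists2 i, i \in B & a i != 0%N.
  apply/exists_inP; apply: contraNT nz_phi => /exists_inPn a0.
  rewrite defphi def_a big1 ?cfunE // => i /a0; rewrite negbK => /eqP->.
  by rewrite mulr0n.
exists i => //; pose psi := \sum_(j in B) 'chi_j *+ (a j - (j == i))%N.
have defphi2 : phi = picfres pi 'chi_i + picfres pi psi.
  rewrite defphi def_a picfres_sum (bigD1 i) //= [in RHS](bigD1 i) //= addrA.
  congr (_ + _); first by rewrite eqxx -mulrS subn1 prednK // lt0n.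
  by apply: eq_bigr => j /andP[_ /negPf ->]; rewrite subn0.
have Npsi : psi \is a character.
  by apply: rpred_sum => j _; rewrite rpredMn ?irr_char.
have [psi0 | nz_psi] := eqVneq psi 0.
  by rewrite defphi2 psi0 /picfres mulr0 addr0.
case: phi_irr; exists (picfres pi 'chi_i), (picfres pi psi); split=> //.
  by exists 'chi_i; rewrite irr_char irr_neq0.
by exists psi.
Qed.

(** In a sum of two nonzero characters equal to ['chi_k], each would have inner product at least 1
    with ['chi_k], against norm 1. *)
Lemma irr_Ipi (gT : finGroupType) pi (G : {group gT}) (k : Iirr G) :
  pi.-group G -> Ipi pi 'chi_k.
Proof.
move=> piG; split.
  by exists 'chi_k; rewrite irr_char irr_neq0 picfres_pgroup.
case=> alpha [beta [[a [Na nz_a ->]] [b [Nb nz_b ->]]]].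
rewrite !picfres_pgroup // => def_k.
have ge1 phi psi : phi \is a character -> psi \is a character -> phi != 0 ->
    'chi_k = phi + psi -> 1 <= '[phi, 'chi_k].
  move=> Nphi Npsi nz_phi defk.
  have [j j_phi] := neq0_has_constt nz_phi.
  have [def_j | ne_jk] := eqVneq j k.
    have /natrP[q def_q] : '[phi, 'chi_k] \in Num.nat by apply: Cnat_cfdot_char_irr.
    rewrite def_q ler1n lt0n -(eqC_nat q 0) -def_q -def_j.
    by move: j_phi; rewrite irr_consttE.
  have : '['chi_k, 'chi_j] = 0 by rewrite cfdot_irr eq_sym (negPf ne_jk).
  rewrite defk cfdotDl => /eqP; rewrite paddr_eq0.
  - by case/andP=> phij0; move: j_phi; rewrite irr_consttE phij0.
  - by rewrite natr_ge0 ?Cnat_cfdot_char_irr.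
  by rewrite natr_ge0 ?Cnat_cfdot_char_irr.
have := lerD (ge1 a b Na Nb nz_a def_k) (ge1 b a Nb Na nz_b (etrans def_k (addrC _ _))).
by rewrite -cfdotDl -def_k cfnorm_irr -(natrD _ 1 1) (ler_nat _ 2 1).
Qed.

(** * Restriction to N, induction back, and the theorem *)

(** The left side is phi times the induced trivial character, which is the inflated regular
    character of G / N. *)
Lemma cfInd_cfRes (gT : finGroupType) (G N : {group gT}) (phi : 'CF(G)) :
    N <| G ->
  'Ind[G] ('Res[N] phi) = \sum_k 'chi_k 1%g *: (('chi[G / N]_k %% N)%CF * phi).
Proof.
move=> nsNG; have res0 : 'Res[N] 'chi[G]_0 = 'chi_0.
  by rewrite !irr0 rmorph1.
have [_ _ _ Ind0] := constt_Ind_ext nsNG res0.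
rewrite -['Res _]mul1r cfIndM ?normal_sub // -irr0 Ind0 mulr_suml.
apply: eq_bigr => k _; rewrite -scalerAl; congr (_ *: (_ * _)).
by rewrite /mul_mod_Iirr /mul_Iirr irr0 mulr1 irrK mod_IirrE.
Qed.

Lemma cfInd_Res_Ind (gT : finGroupType) (G N : {group gT}) (phi : 'CF(N)) :
    N <| G ->
  'Ind[G] ('Res[N] ('Ind[G] phi)) = #|G : N|%:R *: 'Ind[G] phi.
Proof.
move=> nsNG; rewrite -['Res _]mul1r cfIndM ?normal_sub //.
rewrite cfInd_cfun1 // -scalerAl; congr (_ *: _); apply/cfunP=> x.
rewrite cfunE cfuniE //; case: (boolP (x \in N)) => [_ | nNx]; first by rewrite mul1r.
by rewrite mul0r (cfun_on0 (cfInd_normal phi nsNG)).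
Qed.

Theorem theorem5 (gT : finGroupType) (pi : nat_pred) (G N : {group gT})
    (sepG : pi_separable pi G) (nsNG : N <| G)
    (zeta : 'CF(G)) (zeta_irr : Ipi pi zeta)
    (n : nat) (kappa : 'I_n -> 'CF(G / N))
    (kappa_inj : injective kappa)
    (kappa_enum : forall phi : 'CF(G / N),
       Ipi pi phi <-> exists i : 'I_n, phi = kappa i)
    (piGN : pi.-group (G / N)%g)
    (prod_inj : injective (fun i : 'I_n => (kappa i %% N)%CF * zeta))
    (prod_irr : forall i : 'I_n, Ipi pi ((kappa i %% N)%CF * zeta)) :
  Ipi pi ('Res[N] zeta).
Proof.
have sNG := normal_sub nsNG.
have [B basB] := pi_basis_exists (pi_separable_sections sepG).
pose rho i := picfres pi 'chi[G]_i.
have /fin_all_exists[e defe] (k : Iirr (G / N)) : exists i, 'chi_k = kappa i.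
  exact/kappa_enum/irr_Ipi.
have e_inj : injective e.
  by move=> k l eq_e; apply: irr_inj; rewrite !defe eq_e.
have /fin_all_exists2[b Bb defb] (k : Iirr (G / N)) :
    exists2 i, i \in B & ('chi_k %% N)%CF * zeta = rho i.
  by rewrite defe; apply: pi_basis_Ipi (prod_irr (e k)).
have b_inj : injective b.
  move=> k l eq_b; apply/e_inj/prod_inj.
  by rewrite -!defe !defb eq_b.
have IndRes : 'Ind[G] ('Res[N] zeta) = \sum_k 'chi_k 1%g *: rho (b k).
  by rewrite cfInd_cfRes //; apply: eq_bigr => k _; rewrite defb.
have indep c c' : \sum_(i in B) c i *: rho i = \sum_(i in B) c' i *: rho i ->
    {in B, forall i, c i = c' i}.
  move=> /eqP; rewrite -subr_eq0 -sumrB => /eqP sum0 i Bi; apply/eqP.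
  rewrite -subr_eq0; apply/eqP; apply: (pi_basis_indep (c := fun i => c i - c' i)) basB _ i Bi.
  by rewrite -[RHS]sum0; apply: eq_bigr => j _; rewrite scalerBl.
(* Coefficients indexed by Irr(G / N) are pushed along the injection [b], with 0 outside its
   image. *)
pose cb (f : Iirr (G / N) -> algC) i := \sum_(k | b k == i) f k.
have cb_b f k : cb f (b k) = f k.
  by rewrite /cb (eq_bigl (pred1 k)) ?big_pred1_eq // => l; apply: inj_eq.
have sum_b f : \sum_k f k *: rho (b k) = \sum_(i in B) cb f i *: rho i.
  rewrite (partition_big b [in B]) => [|k _]; last exact: Bb.
  by apply: eq_bigr => i _; rewrite scaler_suml; apply: eq_bigr => k /eqP->.
have part_Ind (alpha : 'CF(N)) : pi_partial_char pi alpha ->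
    exists2 a : Iirr G -> nat, 'Ind[G] alpha = \sum_(i in B) (a i)%:R *: rho i
      & 'Ind[G] alpha != 0.
  move=> alphaP; have nz_a := pi_partial_char1_neq0 alphaP.
  case: alphaP nz_a => chi [Nchi nz_chi ->] nz_a.
  have [a def_a] := pi_basis_char basB (cfInd_char G Nchi); exists a.
    by rewrite (picfres_Ind pi chi sNG) def_a; apply: eq_bigr => i _; rewrite scaler_nat.
  apply: contraNneq nz_a => /(congr1 (fun phi : 'CF(G) => phi 1%g)) /eqP.
  by rewrite cfInd1 // [X in _ == X -> _]cfunE mulf_eq0 pnatr_eq0 gtn_eqF.
split.
  have [[chi [Nchi nz_chi def_zeta]] _] := zeta_irr.
  exists ('Res[N] chi); rewrite cfRes_char // def_zeta Res_picfres //; split=> //.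
  by rewrite -char1_eq0 ?cfRes_char // cfRes1 char1_eq0.
case=> alpha [beta [alphaP betaP def_res]].
have [a IndA nzA] := part_Ind _ alphaP.
have [a' IndB nzB] := part_Ind _ betaP.
have sum_a : {in B, forall i, (a i)%:R + (a' i)%:R = cb (fun k => 'chi_k 1%g) i}.
  apply: indep; rewrite -sum_b -IndRes def_res raddfD /= IndA IndB -big_split.
  by apply: eq_bigr => i _; rewrite scalerDl.
(* If the multiplicity of zeta in 'Ind gamma vanished, 'Ind gamma would be 0. *)
have mult_neq0 (gamma : 'CF(N)) (f f' : Iirr G -> nat) :
    'Ind[G] gamma = \sum_(i in B) (f i)%:R *: rho i -> 'Ind[G] gamma != 0 ->
    {in B, forall i, (f i)%:R + (f' i)%:R = cb (fun k => 'chi_k 1%g) i} ->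
  f (b 0) != 0%N.
  move=> Indf nzf sumf; apply: contraNneq nzf => f0.
  pose m := \sum_k (f (b k))%:R * 'chi_k 1%g.
  have Indb : 'Ind[G] gamma = \sum_k (f (b k))%:R *: rho (b k).
    rewrite sum_b Indf; apply: eq_bigr => i Bi; congr (_ *: _).
    (* Outside the image of [b], two natural numbers add up to 0, so both vanish. *)
    have [k /eqP <- | nb] := pickP (fun k => b k == i); first by rewrite cb_b.
    have := sumf i Bi; rewrite /cb !big_pred0 // -natrD => /eqP.
    rewrite (eqC_nat _ 0). by rewrite addn_eq0 => /andP[/eqP-> _].
  have ResInd : 'Res[N] ('Ind[G] gamma) = m *: 'Res[N] zeta.
    rewrite Indb linear_sum scaler_suml; apply: eq_bigr => k _.
    rewrite linearZ /= -defb rmorphM /= cfRes_sub_ker ?cfker_mod //.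
    by rewrite cfMod1 -scalerAl mul1r scalerA.
  have /indep/(_ _ (Bb 0)) : \sum_(i in B) (#|G : N|%:R * cb (fun k => (f (b k))%:R) i) *: rho i
      = \sum_(i in B) (m * cb (fun k => 'chi_k 1%g) i) *: rho i.
    under eq_bigr do rewrite -scalerA.
    under [RHS]eq_bigr do rewrite -scalerA.
    rewrite -!scaler_sumr -!sum_b -Indb -IndRes -(cfInd_Res_Ind _ nsNG) ResInd.
    by rewrite linearZ.
  (* Index [b 0] stands for zeta itself. Comparing its coefficients gives m = |G : N| f (b 0) = 0,
     and m is a sum of nonnegative terms. *)
  rewrite !cb_b f0 mulr0 irr0 cfun11 mulr1 => /esym m0.
  rewrite Indb big1 // => k _.
  have ge0 l : true -> 0 <= (f (b l))%:R * 'chi_l 1%g.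
    by rewrite mulr_ge0 ?ler0n ?char1_ge0 ?irr_char.
  have /eqP : (f (b k))%:R * 'chi_k 1%g = 0 := psumr_eq0P ge0 m0 isT.
  by rewrite mulf_eq0 (negPf (irr1_neq0 k)) orbF => /eqP->; rewrite scale0r.
have a_neq0 : a (b 0) != 0%N by apply: mult_neq0 IndA nzA sum_a.
have a'_neq0 : a' (b 0) != 0%N.
  by apply: (mult_neq0 _ _ a) IndB nzB _ => i Bi; rewrite addrC sum_a.
have /eqP := sum_a _ (Bb 0); rewrite cb_b irr0 cfun11 -natrD (eqC_nat _ 1).
by case: (a (b 0)) (a' (b 0)) a_neq0 a'_neq0 => [|u] [|v] // _ _; rewrite addSn addnS.
Qed.
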